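(* Assume the Continuum Hypothesis. Let $(X,\tau)$ be a productively Lindelöf space of countable tightness. Then $X$ is powerfully Lindelöf.
   Context: The Continuum Hypothesis is the statement $2^{\aleph_0}=\aleph_1$. Terminology follows Engelking; in particular ''regular'' includes $\mathsf{T}_1$, and every Lindelöf space is regular by definition: a space is Lindelöf if it is regular and every open cover of it has a countable subcover. A space $X$ is productively Lindelöf if $X\times Y$ is Lindelöf for every Lindelöf space $Y$. A space $X$ is powerfully Lindelöf if $X^\omega$ (with the product topology) is Lindelöf. The tightness $t(X)$ of a space $X$ is the minimum cardinal $\kappa$ such that whenever $x\in\mathrm{cl}(A)$ for some $A\subseteq X$, there exists $B\subseteq A$ with $|B|\leq\kappa$ and $x\in\mathrm{cl}(B)$. $X$ has countable tightness if $t(X)\leq\omega$. *)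

(* Defs.v *)
From HB Require Import structures.
From mathcomp Require Import all_boot all_order all_algebra.
From mathcomp Require Import all_classical topology.

Set Implicit Arguments.
Unset Strict Implicit.
Unset Printing Implicit Defensive.

Local Open Scope classical_set_scope.
Local Open Scope card_scope.

(* Cardinals are represented by sets, compared with [#<=] and [#=].
   [A] has cardinality aleph_1, the least uncountable cardinal. *)
Definition has_card_aleph1 (T : Type) (A : set T) : Prop :=
  ~ countable A /\
  forall (U : Type) (B : set U), ~ countable B -> A #<= B.

(* [set nat] is the power set of the natural numbers *)
Definition continuum_hypothesis : Prop := has_card_aleph1 [set: set nat].

(* The library's [regular_space] does not include T1. *)
Definition lindelof (X : topologicalType) : Prop :=
  [/\ @accessible_space X,
      regular_space X &
      forall C : set (set X), C `<=` open -> \bigcup_(U in C) U = [set: X] ->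
        exists D : set (set X),
          [/\ D `<=` C, countable D & \bigcup_(U in D) U = [set: X]]].

Definition productively_lindelof (X : topologicalType) : Prop :=
  forall Y : topologicalType, lindelof Y -> lindelof (X * Y)%type.

Definition powerfully_lindelof (X : topologicalType) : Prop :=
  lindelof (prod_topology (fun _ : nat => X)).

(* t(X) <= |K|; the defining property of tightness is monotone in the cardinal,
   so it holds at |K| iff the minimum is at most |K|. *)
Definition tightness_le (X : topologicalType) (T : Type) (K : set T) : Prop :=
  forall (A : set X) (x : X), closure A x ->
    exists B : set X, [/\ B `<=` A, B #<= K & closure B x].

Definition countable_tightness (X : topologicalType) : Prop :=
  tightness_le X [set: nat].

(* Main.v *)
Require Import Defs.
From HB Require Import structures.
From mathcomp Require Import all_boot all_order all_algebra.
From mathcomp Require Import all_classical wochoice topology.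

Set Implicit Arguments.
Unset Strict Implicit.
Unset Printing Implicit Defensive.

Local Open Scope classical_set_scope.
Local Open Scope card_scope.

(** Let [X] be productively Lindelof and of countable tightness.

    The Continuum Hypothesis enters through Alster's theorem, [alster]. Let now
    [X] be a productively Lindelof subset of a Cantor cube with at most continuum many
    coordinates, and enlarge each compact [D] inside [X] to a closed G_delta set
    by freeing all but countably many coordinates; then countably many enlarged
    sets cover [X]. Suppose not. List the enlarged sets [G b] in type omega_1 and
    choose points [x m] of [X] outside every [G b] with [b] before [m]. If some
    Lindelof set [Z] disjoint from [X] is such that every open set around [Z]
    contains all but countably many [x m], then isolating the points [x m] in the
    union of [Z] and [{x m}] gives a Lindelof space whose product with [X] is not
    Lindelof, because the pairs [(x m, x m)] can only be covered one by one
    ([concentrated_not_productively_lindelof]). This is used twice. First, [Z] is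
    the set of points that countably many coordinates show to lie outside [X];
    hence the projection of [X] to countably many coordinates is sigma-compact
    ([sigma_compact_projection]). Then [Z] is a union of omega_1 such sets, with
    the earlier [G b] removed from each. The point is that a compact [C] missing
    [Z] lies in countably many [G b]: otherwise shrink [C] to the set of points
    none of whose neighbourhoods in [C] is covered in this way, and apply the
    Baire category theorem there, at a stage closed under the choice of certain
    witnesses. Sigma-compactness makes the sets that cover [C] closed, and Baire
    category puts a nonempty open piece of the shrunken set into [X] or into one
    [G b], both of which are impossible.

    A space of countable tightness may have a large weight, even if it has a
    dense subset [A] of size at most continuum. But open sets that separate
    closures of countable subsets of [A] define a relation between the closure
    of [A] and a Cantor cube with continuum many coordinates, and on the closure
    of each countable subset of [A] they recover the topology. By tightness this
    suffices to see that compact subsets of the cube correspond to compact subsets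
    of [X], so Alster's covering property passes to the closure of [A]. Freezing
    coordinates one at a time, the property yields that the countable power of the
    closure of [A] is Lindelof ([lindelof_in_power_closure]).

    Finally take an open cover of the countable power of [X]. For each sequence
    [u] in [X], countably many members cover the power of the closure of [u]. Close
    off under the choice of a point that is missed by countably many of these
    members, whenever they fail to cover. The result is a set [A] of size at most
    continuum. By tightness the chosen members cover the power of the closure of
    [A], hence countably many of them do; they miss no point of the power of [A],
    and so cover the power of [X]. *)

(** * Countable sets and Lindelof subsets *)

Lemma countable_inj (A B : Type) (f : A -> B) (S : set A) :
  {in S &, injective f} -> countable (f @` S) -> countable S.
Proof.
move=> injf /countable_injP[g injg]; apply/countable_injP; exists (g \o f).
move=> x y xS yS /= gfxy; apply: injf => //.
by apply: injg gfxy; rewrite inE; [exists x|exists y] => //; exact/set_mem.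
Qed.

Lemma countable_image (A B : Type) (f : A -> B) (S : set A) :
  countable S -> countable (f @` S).
Proof. by move=> cS; apply: card_le_trans cS; exact: card_image_le. Qed.

Lemma sub_countable_set (A : Type) (S R : set A) :
  S `<=` R -> countable R -> countable S.
Proof. by move=> SR; apply: sub_countable; exact: subset_card_le. Qed.

Lemma countable_setU (A : Type) (S R : set A) :
  countable S -> countable R -> countable (S `|` R).
Proof.
move=> cS cR.
have -> : S `|` R = \bigcup_(b in [set: bool]) (if b then S else R).
  rewrite eqEsubset; split=> x; first by case=> ?; [exists true|exists false].
  by case=> -[] _ ?; [left|right].
by apply: bigcup_countable => [|[] _ //]; exact: countableP.
Qed.

Lemma countable_representatives (A B : Type) (f : A -> B) (S : set A)
    (D : set B) :
  countable D -> D `<=` f @` S ->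
  exists Q, [/\ Q `<=` S, countable Q & D = f @` Q].
Proof.
move=> cD DS.
have /choice[g gP] : forall u, exists o : option A,
    D u -> exists x, [/\ o = Some x, S x & f x = u].
  move=> u; have [/DS[x Sx fx]|nDu] := pselect (D u).
    by exists (Some x) => _; exists x.
  by exists None => /nDu.
have QP : forall x, (exists2 u, D u & g u = Some x) ->
    [/\ S x, D (f x) & g (f x) = Some x].
  move=> x [u Du gu]; have [y [guy Sy fy]] := gP u Du.
  move: guy; rewrite gu => -[xy]; rewrite -xy in Sy fy.
  by rewrite fy.
exists [set x | exists2 u, D u & g u = Some x]; split.
- by move=> x /QP[].
- apply: (@countable_inj _ _ f).
    move=> x y /set_mem/QP[_ _ gx] /set_mem/QP[_ _ gy] fxy.
    by move: gx; rewrite fxy gy => -[].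
  by apply: sub_countable_set cD => _ [x /QP[_ + _] <-].
- rewrite eqEsubset; split=> [u Du|_ [x /QP[_ + _] <- //]].
  by have [x [gu Sx fx]] := gP u Du; exists x => //; exists u.
Qed.

(** Covers are given by neighbourhood assignments, since every cover of the proof
    arises by choosing a neighbourhood of each point. *)
Definition lindelof_in (X : topologicalType) (S : set X) : Prop :=
  forall O : X -> set X, (forall x, S x -> nbhs x (O x)) ->
  exists Q : set X,
    [/\ Q `<=` S, countable Q & S `<=` \bigcup_(q in Q) O q].

Lemma lindelof_lindelof_in (X : topologicalType) :
  lindelof X -> lindelof_in [set: X].
Proof.
move=> [_ _ covX] O nO.
have [||D [DC cD Dcov]] := covX [set (O x)° | x in [set: X]].
- by move=> _ [x _ <-]; exact: open_interior.
- rewrite -subTset => x _; exists (O x)°; first by exists x.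
  exact: nO.
have [Q [QS cQ DE]] := countable_representatives cD DC.
exists Q; split => //; rewrite -Dcov => x [U DU Ux].
move: DU Ux; rewrite DE => -[q Qq <-] Oqx.
by exists q => //; exact: interior_subset.
Qed.

Lemma lindelof_in_lindelof (X : topologicalType) :
  accessible_space X -> regular_space X -> lindelof_in [set: X] -> lindelof X.
Proof.
move=> aX rX lX; split => // C Cop Ccov.
have /choice[O OP] : forall x : X, exists U, C U /\ U x.
  by move=> x; have : [set: X] x by []; rewrite -Ccov => -[U CU Ux]; exists U.
have [|Q [_ cQ Qcov]] := lX O.
  move=> x _; have [/Cop oO Ox] := OP x; exact: open_nbhs_nbhs.
exists (O @` Q); split.
- by move=> _ [x _ <-]; have [] := OP x.
- exact: countable_image.
- rewrite -subTset => x /Qcov[q Qq Oqx].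
  by exists (O q) => //; exists q.
Qed.

Lemma lindelof_in_image (X Y : topologicalType) (f : X -> Y) (S : set X) :
  continuous f -> lindelof_in S -> lindelof_in (f @` S).
Proof.
move=> cf lS O nO.
have [|Q [QS cQ Qcov]] := lS (fun x => f @^-1` O (f x)).
  by move=> x Sx; apply: cf; apply: nO; exists x.
exists (f @` Q); split; [exact: image_subset|exact: countable_image|].
move=> _ [x /Qcov[q Qq Oqx] <-]; exists (f q) => //; by exists q.
Qed.

Lemma lindelof_in_closed (X : topologicalType) (S C : set X) :
  closed C -> lindelof_in S -> lindelof_in (S `&` C).
Proof.
move=> clC lS O nO.
(* points outside C receive the complement of C, which cannot help to cover C *)
have [|Q [QS cQ Qcov]] := lS
    (fun x => [set y | C x -> O x y] `&` [set y | ~ C x -> ~ C y]).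
  move=> x Sx; have [Cx|nCx] := pselect (C x).
    by apply: filterS (nO x (conj Sx Cx)) => y Oy; split.
  have : nbhs x (~` C) by apply: open_nbhs_nbhs; split => //; exact: closed_openC.
  by apply: filterS => y nCy; split.
exists (Q `&` C); split; first exact: setSI.
  by apply: sub_countable_set cQ => x [].
move=> x [Sx Cx]; have [q Qq [/= Oqx nCqx]] := Qcov x Sx.
have Cq : C q by apply: contrapT => /nCqx.
by exists q => //; exact: Oqx.
Qed.

Lemma lindelof_in_bigcup (X : topologicalType) (J : Type) (D : set J)
    (S : J -> set X) :
  countable D -> (forall j, D j -> lindelof_in (S j)) ->
  lindelof_in (\bigcup_(j in D) S j).
Proof.
move=> cD lS O nO.
have /choice[Q QP] : forall j, exists Q, D j ->
    [/\ Q `<=` S j, countable Q & S j `<=` \bigcup_(q in Q) O q].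
  move=> j; have [Dj|nDj] := pselect (D j); last by exists set0 => /nDj.
  have [|Q QP] := lS j Dj O; last by exists Q.
  by move=> x Sx; apply: nO; exists j.
exists (\bigcup_(j in D) Q j); split.
- by move=> x [j Dj Qx]; exists j => //; have [+ _ _] := QP j Dj; exact.
- by apply: bigcup_countable => // j /QP[].
- move=> x [j Dj Sx]; have [_ _ /(_ x Sx)[q Qq Oqx]] := QP j Dj.
  by exists q => //; exists j.
Qed.

Lemma lindelof_in_countable (X : topologicalType) (S : set X) :
  countable S -> lindelof_in S.
Proof.
move=> cS O nO; exists S; split => // x Sx; exists x => //.
exact: nbhs_singleton (nO x Sx).
Qed.

Lemma compact_finite_subcover (X : topologicalType) (A : set X)
    (O : X -> set X) :
  compact A -> (forall x, A x -> nbhs x (O x)) ->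
  exists F : seq X, (forall x, x \in F -> A x) /\
    forall x, A x -> exists2 y, y \in F & O y x.
Proof.
move=> /compact_near_coveringP cA nO.
pose FS : set_system (seq X) := [set S | exists F0 : seq X,
  (forall x, x \in F0 -> A x) /\
  forall F, (forall x, x \in F -> A x) -> {subset F0 <= F} -> S F].
have FSF : Filter FS.
  split.
  - by exists [::].
  - move=> S R [F [FA FS_]] [G [GA GR]]; exists (F ++ G); split.
      by move=> x; rewrite mem_cat => /orP[/FA|/GA].
    move=> H HA FGH; split; [apply: FS_|apply: GR] => // x xF; apply: FGH.
      by rewrite mem_cat xF.
    by rewrite mem_cat xF orbT.
  - by move=> S R SR [F [FA FS_]]; exists F; split => // G GA FG; apply/SR/FS_.
have [x Ax|F [FA]] := cA (seq X) FS (fun F x => exists2 y, y \in F & O y x) FSF.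
  exists (O x, [set F | x \in F]) => /=.
    split; first exact: nO.
    exists [:: x]; split; first by move=> y; rewrite inE => /eqP ->.
    by move=> F FA; apply; rewrite mem_head.
  by move=> [y F] [/= Oy xF]; exists x.
by move=> /(_ F FA (fun x xF => xF)) cov; exists F.
Qed.
(** * Product spaces *)

Section ProductTopology.
Variables (I : choiceType) (K : I -> topologicalType).
Implicit Types (p : prod_topology K) (U : forall i, set (K i)).

Definition box (F : seq I) U : set (prod_topology K) :=
  [set g | forall i, i \in F -> U i (g i)].

Lemma box_nbhs F U p : (forall i, i \in F -> nbhs (p i) (U i)) ->
  nbhs p (box F U).
Proof.
move=> nU.
elim: F nU => [|i F IH] nU.
  by apply: filterS filterT => g _ i; rewrite in_nil.
have nF : nbhs p (box F U).
  by apply: IH => j jF; apply: nU; rewrite in_cons jF orbT.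
have ni : nbhs p (proj i @^-1` U i).
  by apply: proj_continuous; apply: nU; rewrite mem_head.
apply: filterS (filterI ni nF) => g [gi gF] j.
by rewrite in_cons => /orP[/eqP->|/gF].
Qed.

Lemma nbhs_box p (A : set (prod_topology K)) : nbhs p A ->
  exists F U, (forall i, open_nbhs (p i) (U i)) /\ box F U `<=` A.
Proof.
(* the sets containing a box around p form a filter that converges to p *)
pose P : set_system (prod_topology K) := [set A | exists F U,
  (forall i, open_nbhs (p i) (U i)) /\ box F U `<=` A].
have FP : Filter P.
  split.
  - by exists [::], (fun=> setT); split => // i; exact: open_nbhsT.
  - move=> B C [F [U [oU UA]]] [G [V [oV VB]]].
    exists (F ++ G), (fun i => U i `&` V i); split.
      by move=> i; exact: open_nbhsI.
    move=> g gUV; split; [apply: UA|apply: VB] => i iF.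
      by have [] := gUV i; rewrite ?mem_cat ?iF.
    by have [] := gUV i; rewrite ?mem_cat ?iF ?orbT.
  - by move=> B C AB [F [U [oU UA]]]; exists F, U; split => //; exact: subset_trans AB.
suff : P --> p by exact.
apply/cvg_sup => i B; rewrite (@nbhsE (initial_topology _)) => -[C [[O oO <-] Op] CB].
(* O at the coordinate i, and the whole space at every other coordinate *)
exists [:: i], (fun j => [set y | forall e : i = j, O (ecast j (K j) (esym e) y)]).
split.
  move=> j; have [ij|nij] := pselect (i = j).
    case: j / ij.
    suff -> : [set y | forall e : i = i, O (ecast i0 (K i0) (esym e) y)] = O by [].
    rewrite eqEsubset; split=> y; first by move/(_ erefl).
    by move=> Oy e; rewrite (Prop_irrelevance e erefl).
  suff -> : [set y | forall e : i = j, O (ecast i0 (K i0) (esym e) y)] = setT.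
    exact: open_nbhsT.
  by rewrite -subTset => y _ e.
move=> g gO; apply: CB; exact: (gO i (mem_head _ _) erefl).
Qed.

Lemma box_closure F U : closure (box F U) `<=` box F (fun i => closure (U i)).
Proof.
move=> p clp i iF B nB.
have [g [gU gB]] : box F U `&` proj i @^-1` B !=set0.
  by apply: clp; exact: proj_continuous.
by exists (g i); split => //; exact: gU.
Qed.

Lemma regular_prod_topology :
  (forall i, regular_space (K i)) -> regular_space (prod_topology K).
Proof.
move=> rK p A /nbhs_box[F [U [oU UA]]].
have shrink i : {V | nbhs (p i) V /\ closure V `<=` U i}.
  apply: cid; have [V nV clV] := rK i (p i) (U i) (open_nbhs_nbhs (oU i)).
  by exists V.
pose V i := sval (shrink i); have VP i := svalP (shrink i).
exists (box F V); first by apply: box_nbhs => i _; have [] := VP i.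
move=> g /box_closure gV; apply: UA => i iF.
by have [_] := VP i; apply; exact: gV.
Qed.

Lemma accessible_prod_topology :
  (forall i, accessible_space (K i)) -> accessible_space (prod_topology K).
Proof.
move=> aK p q /eqP pq.
have [i /eqP piq] : exists i, p i <> q i.
  by apply/existsNP => e; apply: pq; exact: functional_extensionality_dep.
have [A [oA pA qA]] := aK i _ _ piq.
exists (proj i @^-1` A); split; rewrite ?inE.
- by apply: open_comp => // x _; exact: proj_continuous.
- exact/set_mem.
- exact: set_mem qA.
Qed.

End ProductTopology.

Section Product.
Variables X Y : topologicalType.

Lemma regular_prod :
  regular_space X -> regular_space Y -> regular_space (X * Y)%type.
Proof.
move=> rX rY [x y] A [[U V] /= [nU nV] UVA].
have [U' nU' clU'] := rX x U nU; have [V' nV' clV'] := rY y V nV.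
exists (U' `*` V'); first by exists (U', V').
move=> [a b] clab; apply: UVA; split => /=.
  apply: clU' => B nB; have [|[c d] [[/= U'c _] [/= Bc _]]] := clab (B `*` setT).
    by exists (B, setT) => //; split => //; exact: filterT.
  by exists c.
apply: clV' => B nB; have [|[c d] [[/= _ V'd] [/= _ Bd]]] := clab (setT `*` B).
  by exists (setT, B) => //; split => //; exact: filterT.
by exists d.
Qed.

Lemma accessible_prod :
  accessible_space X -> accessible_space Y -> accessible_space (X * Y)%type.
Proof.
move=> aX aY [x y] [x' y'] /eqP neq.
have [/eqP xx'|xx'] := boolP (x == x'); last first.
  have [A [oA xA x'A]] := aX _ _ xx'; exists (fst @^-1` A); split; rewrite ?inE.
  - by apply: open_comp => // z _; exact: cvg_fst.
  - exact/set_mem.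
  - exact: set_mem x'A.
have yy' : y != y' by apply/eqP => e; apply: neq; rewrite xx' e.
have [A [oA yA y'A]] := aY _ _ yy'; exists (snd @^-1` A); split; rewrite ?inE.
- by apply: open_comp => // z _; exact: cvg_snd.
- exact/set_mem.
- exact: set_mem y'A.
Qed.

(** The tube lemma: a neighbourhood assignment on [X * Y] is, over each point
    of [Y], refined by one finite subcover on a whole strip. *)
Lemma lindelof_in_compact_prod : compact [set: X] -> lindelof_in [set: Y] ->
  lindelof_in [set: X * Y].
Proof.
move=> cX lY O nO.
have tube (y : Y) : exists Q : set (X * Y),
    countable Q /\ nbhs y [set y' | forall x, (\bigcup_(q in Q) O q) (x, y')].
  have /choice[UV UVP] : forall x, exists UV : set X * set Y,
      [/\ open_nbhs x UV.1, nbhs y UV.2 & UV.1 `*` UV.2 `<=` O (x, y)].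
    move=> x; have [[U V] /= [nU nV] UVO] := nO (x, y) I.
    exists (U°, V); split => //=; first by split => //; exact: open_interior.
    by move=> [a b] [/= /interior_subset ? ?]; exact: UVO.
  have [x _|F [_ Fcov]] := compact_finite_subcover (O := fun x => (UV x).1) cX.
    by apply: open_nbhs_nbhs; have [] := UVP x.
  exists ((fun x => (x, y)) @` [set` F]); split.
    by apply: countable_image; exact/finite_set_countable/finite_seq.
  have : nbhs y [set y' | forall x, x \in F -> (UV x).2 y'].
    elim: F {Fcov} => [|x F IH]; first by apply: filterS filterT.
    have [_ nV _] := UVP x; apply: filterS (filterI nV IH) => y' [Vy' Fy'] z.
    by rewrite in_cons => /orP[/eqP->|/Fy'].
  apply: filterS => y' Fy' x; have [z zF zx] := Fcov x I.
  exists (z, y); first by exists z.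
  by have [_ _] := UVP z; apply; split => //=; exact: Fy'.
have /choice[Q QP] := tube.
have [y _|R [_ cR Rcov]] :=
    lY (fun y : Y => [set y' | forall x, (\bigcup_(q in Q y) O q) (x, y')]).
  by have [] := QP y.
exists (\bigcup_(y in R) Q y); split => //.
  by apply: bigcup_countable => // y _; have [] := QP y.
move=> [x y'] _; have [y Ry /(_ x)[q Qq Oq]] := Rcov y' I.
by exists q => //; exists y.
Qed.

End Product.

Lemma lindelof_bool : lindelof bool.
Proof.
apply: lindelof_in_lindelof.
- exact/hausdorff_accessible/discrete_hausdorff.
- exact: uniform_regular.
- exact/lindelof_in_countable/countableP.
Qed.

Lemma productively_lindelof_lindelof (X : topologicalType) :
  productively_lindelof X -> lindelof X.
Proof.
move=> prodX; have lXb := prodX _ lindelof_bool; have [aXb rXb _] := lXb.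
have slice (x : X) (B : set (X * bool)) : nbhs (x, true) B ->
    nbhs x [set z | B (z, true)].
  move=> [[U V] /= [nU nV] UVB]; apply: filterS nU => z Uz; apply: UVB.
  by split => //; exact: nbhs_singleton nV.
apply: lindelof_in_lindelof.
- move=> x y xy; have [|A [oA xA yA]] := aXb (x, true) (y, true).
    by apply: contra_neq xy => -[].
  exists [set z | A (z, true)]; split; rewrite ?inE.
  + by rewrite openE => z Az; apply: slice; exact: open_nbhs_nbhs.
  + exact: set_mem xA.
  + exact: set_mem yA.
- move=> x V nV; have [|W nW WV] := rXb (x, true) (V `*` setT).
    by exists (V, setT) => //; split => //; exact: filterT.
  exists [set z | W (z, true)]; first exact: slice.
  move=> y cly; have [] // := WV (y, true) _.
  by move=> B /slice nB; have [z [Wz Bz]] := cly _ nB; exists (z, true).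
- have -> : [set: X] = fst @` [set: X * bool].
    by rewrite eqEsubset; split=> // x _; exists (x, true).
  apply: lindelof_in_image; first by move=> p; exact: cvg_fst.
  exact: lindelof_lindelof_in.
Qed.

(** * The Cantor cube *)

Notation cube I := (prod_topology (fun _ : I => bool)).

Section Cube.
Variable I : choiceType.
Implicit Types (J : set I) (F : seq I) (a b c : cube I) (S C : set (cube I)).

Definition agree J a b := forall i, J i -> a i = b i.

Definition sat J S : set (cube I) := [set a | exists2 x, S x & agree J a x].

Definition saturated J S := forall a b, agree J a b -> S a -> S b.

Definition cyl F a : set (cube I) := [set b | agree [set` F] a b].

Lemma agree_sym J a b : agree J a b -> agree J b a.
Proof. by move=> ab i Ji; rewrite ab. Qed.

Lemma agree_trans J a b c : agree J a b -> agree J b c -> agree J a c.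
Proof. by move=> ab bc i Ji; rewrite ab // bc. Qed.

Lemma agreeS J J' a b : J `<=` J' -> agree J' a b -> agree J a b.
Proof. by move=> JJ' ab i /JJ'; exact: ab. Qed.

Lemma sub_sat J S : S `<=` sat J S.
Proof. by move=> x Sx; exists x. Qed.

Lemma satS J S S' : S `<=` S' -> sat J S `<=` sat J S'.
Proof. by move=> SS' a [x /SS' Sx ax]; exists x. Qed.

Lemma sat_anti J J' S : J `<=` J' -> sat J' S `<=` sat J S.
Proof. by move=> JJ' a [x Sx ax]; exists x => //; exact: agreeS ax. Qed.

Lemma sat_saturated J S : saturated J (sat J S).
Proof.
by move=> a b ab [x Sx ax]; exists x => //; exact: agree_trans (agree_sym ab) ax.
Qed.

Lemma saturatedS J J' S : J `<=` J' -> saturated J S -> saturated J' S.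
Proof. by move=> JJ' sS a b ab; apply: sS; exact: agreeS ab. Qed.

Lemma saturated_sat J S : saturated J S -> sat J S `<=` S.
Proof. by move=> sS a [x Sx ax]; apply: sS Sx; exact: agree_sym. Qed.

Lemma compact_cube : compact [set: cube I].
Proof.
have := @tychonoff I (fun=> bool) (fun=> setT) (fun=> bool_compact).
by congr compact; rewrite eqEsubset.
Qed.

Lemma closed_compact_cube C : closed C -> compact C.
Proof. by move=> clC; apply: subclosed_compact clC compact_cube _. Qed.

Lemma nbhs_coordinate i a : nbhs a [set b : cube I | b i = a i].
Proof.
have : nbhs a (box [:: i] (fun j => [set x | x = a j])).
  by apply: box_nbhs => j _; exact/principal_filterP.
by apply: filterS => b; apply; rewrite mem_head.
Qed.

Lemma cyl_nbhs F a : nbhs a (cyl F a).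
Proof.
elim: F => [|i F IH]; first by apply: filterS filterT => b _ i.
apply: filterS (filterI (nbhs_coordinate i a) IH) => b [bi bF] j.
by rewrite /= in_cons => /orP[/eqP->|/bF].
Qed.

Lemma nbhs_cyl a (A : set (cube I)) : nbhs a A -> exists F, cyl F a `<=` A.
Proof.
move=> /nbhs_box[F [U [oU UA]]]; exists F => b ab; apply: UA => i iF.
by rewrite -ab //; have [] := oU i.
Qed.

Lemma cyl_closed F a : closed (cyl F a).
Proof.
move=> b /(_ _ (cyl_nbhs F b))[c [ac bc]].
exact: agree_trans ac (agree_sym bc).
Qed.

Lemma closed_point a : closed [set a].
Proof.
move=> b clb; apply: funext => i.
by have [_ [-> /= ->]] := clb _ (nbhs_coordinate i b).
Qed.

(** Compactness of [C] replaces the coordinates of [J], possibly infinitely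
    many, by finitely many of them. *)
Lemma closed_separation J C a : closed C ->
  (forall c, C c -> ~ agree J a c) ->
  exists F, (forall i, i \in F -> J i) /\
    forall c, C c -> ~ agree [set` F] a c.
Proof.
move=> clC nac.
have /choice[k kP] : forall c, exists o : option I, C c ->
    exists i, [/\ o = Some i, J i & a i <> c i].
  move=> c; have [Cc|nCc] := pselect (C c); last by exists None => /nCc.
  have /existsNP[i /not_implyP[Ji aci]] := nac c Cc.
  by exists (Some i) => _; exists i.
have [c Cc|F [FC cov]] := @compact_finite_subcover _ C
    (fun c => [set b | forall i, k c = Some i -> b i = c i]) (closed_compact_cube clC).
  have [i [-> _ _]] := kP c Cc.
  by apply: filterS (nbhs_coordinate i c) => b bi _ [<-].
exists (pmap k F); split=> [i|c Cc ac].
  rewrite mem_pmap => /mapP[c cF ick]; have [j [kj Jj _]] := kP c (FC c cF).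
  by move: ick; rewrite kj => -[->].
have [d dF dc] := cov c Cc; have [i [ki Ji adi]] := kP d (FC d dF).
apply: adi; rewrite -(dc i ki); apply: ac.
by rewrite /= mem_pmap -ki; apply: map_f.
Qed.

Lemma sat_closed J C : closed C -> closed (sat J C).
Proof.
move=> clC a cla; apply: contrapT => nsa.
have [|F [FJ nac]] := @closed_separation J C a clC.
  by move=> c Cc ac; apply: nsa; exists c.
have [b [[c Cc bc] ab]] := cla _ (cyl_nbhs F a).
apply: (nac c Cc); apply: agree_trans ab _; apply: agreeS bc => i; exact: FJ.
Qed.

(** A class of agreement on [J] is compact, so it is covered by a finite
    subcover together with a whole cylinder over [J]; and when [J] is countable
    there are only countably many such cylinders. *)
Lemma lindelof_in_saturated J S : countable J -> saturated J S -> lindelof_in S.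
Proof.
move=> /countable_injP[g injg] sS O nO.
have /choice[k kP] : forall r, exists FQ : seq I * seq (cube I), S r ->
    [/\ forall i, i \in FQ.1 -> J i, forall q, q \in FQ.2 -> S q &
        forall b, cyl FQ.1 r b -> exists2 q, q \in FQ.2 & O q b].
  move=> r; have [Sr|nSr] := pselect (S r); last by exists ([::], [::]) => /nSr.
  have clr : closed (sat J [set r]) by exact/sat_closed/closed_point.
  have rS b : sat J [set r] b -> S b.
    by move=> [_ -> br]; apply: sS Sr; exact: agree_sym.
  have [q /rS Sq|Q [QS Qcov]] := @compact_finite_subcover _ _ (fun q => (O q)°)
      (closed_compact_cube clr).
    by apply: nbhs_interior; exact: nO.
  pose C := ~` (\bigcup_(q in [set` Q]) (O q)°).
  have clC : closed C.
    by apply: open_closedC; apply: bigcup_open => q _; exact: open_interior.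
  have [|F [FJ nac]] := @closed_separation J C r clC.
    move=> c Cc rc; apply: Cc; have [|q qQ Oqc] := Qcov c.
      by exists r => //; exact: agree_sym.
    by exists q.
  exists (F, Q) => _; split => //= [q /QS/rS //|b rb].
  apply: contrapT => nq; apply: (nac b) => // -[q qQ /interior_subset Oqb].
  by apply: nq; exists q.
pose key r := [seq (g i, r i) | i <- (k r).1].
have [] := @countable_representatives _ _ key S (key @` S) (countableP _) => //.
move=> R [RS cR keyR].
exists (\bigcup_(r in R) [set` (k r).2]); split.
- by move=> q [r /RS Sr qr]; have [_ + _] := kP r Sr; exact.
- apply: bigcup_countable => // r _; exact/finite_set_countable/finite_seq.
- move=> s Ss; have : (key @` S) (key s) by exists s.
  rewrite keyR => -[r Rr rs]; have [rJ _ rcov] := kP r (RS r Rr).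
  have [sJ _ _] := kP s Ss.
  have [|q qr Oqs] := rcov s; last by exists q => //; exists r.
  move=> i ir; have : (g i, r i) \in key s by rewrite -rs; apply: map_f.
  case/mapP => j js [gij ->]; congr s; apply: esym; apply: injg => //.
  - by rewrite inE; exact: rJ.
  - by rewrite inE; exact: sJ.
Qed.

End Cube.

(** * Sets of size at most continuum, and omega_1 *)

Definition continuum_sized (K : Type) : Prop :=
  exists k : K -> set nat, injective k.

Lemma continuum_sized_inj (A B : Type) (f : A -> B) :
  injective f -> continuum_sized B -> continuum_sized A.
Proof. by move=> injf [k injk]; exists (k \o f); exact: inj_comp. Qed.

Lemma continuum_sized_set (S : countType) : continuum_sized (set S).
Proof.
exists (fun A => pickle @` A) => A B AB.
have sub C D : pickle @` C = pickle @` D -> C `<=` (D : set S).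
  move=> CD x Cx; have : (pickle @` D) (pickle x) by rewrite -CD; exists x.
  by move=> [y Dy /(pcan_inj (@pickleK S)) <-].
by rewrite eqEsubset; split; apply: sub.
Qed.

Lemma continuum_sized_seq (K : Type) :
  continuum_sized K -> continuum_sized (nat -> K).
Proof.
move=> [k injk].
apply: (@continuum_sized_inj _ (set (nat * nat)%type)
  (fun f => [set p | k (f p.1) p.2])); last exact: continuum_sized_set.
move=> f g fg; apply: funext => n; apply: injk; apply: funext => m.
by have := congr1 (fun A : set (nat * nat) => A (n, m)) fg.
Qed.

Lemma continuum_sized_prod (A B : Type) :
  continuum_sized A -> continuum_sized B -> continuum_sized (A * B).
Proof.
move=> [k injk] [l injl].
apply: (@continuum_sized_inj _ (set (nat + nat)%type)
  (fun p => [set s | match s with inl n => k p.1 n | inr n => l p.2 n end]));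
  last exact: continuum_sized_set.
move=> [a b] [a' b'] e; congr (_, _).
  apply: injk; apply: funext => n.
  by have := congr1 (fun S : set (nat + nat) => S (inl n)) e.
apply: injl; apply: funext => n.
by have := congr1 (fun S : set (nat + nat) => S (inr n)) e.
Qed.

(** The enumeration is total, so [d0] is listed whenever an element of [set nat]
    codes nothing in [D]. *)
Lemma continuum_enumeration (K A : Type) (f : K -> A) (D : set A) (d0 : A) :
  continuum_sized K -> D `<=` range f -> D d0 ->
  exists G : set nat -> A, (forall m, D (G m)) /\
    forall d, D d -> exists m, G m = d.
Proof.
move=> [k injk] Df Dd0.
have /choice[G GP] : forall m, exists d, D d /\ forall x, k x = m -> D (f x) -> d = f x.
  move=> m; have [[x [kx Dfx]]|nx] := pselect (exists x, k x = m /\ D (f x)).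
    by exists (f x); split => // y ky _; congr f; apply: injk; rewrite kx.
  by exists d0; split => // x kx Dfx; case: nx; exists x.
exists G; split=> [m|d Dd]; first by have [] := GP m.
have [x _ fx] := Df d Dd; exists (k x).
by have [_ Gk] := GP (k x); rewrite (Gk x) ?fx.
Qed.

(** The order type of the first uncountable ordinal. *)
Definition omega1_order (M : Type) (lt : M -> M -> Prop) : Prop :=
  [/\ forall a b c, lt a b -> lt b c -> lt a c,
      forall a b, lt a b \/ a = b \/ lt b a,
      forall P : set M, P !=set0 -> exists2 m, P m & forall b, P b -> ~ lt b m,
      forall a, countable [set b | lt b a] &
      ~ countable [set: M]].

Lemma omega1_order_bounded (M : Type) (lt : M -> M -> Prop) (Q : set M) :
  omega1_order lt -> countable Q -> exists g, forall q, Q q -> lt q g.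
Proof.
move=> [_ tot _ cseg ucM] cQ; apply: contrapT => nb; apply: ucM.
apply: (@sub_countable_set _ _ (\bigcup_(q in Q) ([set q] `|` [set b | lt b q]))).
  move=> g _; have /existsNP[q /not_implyP[Qq nqg]] :=
    (forallNP _).2 nb g.
  exists q => //; have [//|[->|gq]] := tot q g; [by left|by right].
apply: bigcup_countable => // q _.
exact: countable_setU (countable1 q) (cseg q).
Qed.

(** A well-order of the continuum need not have type omega_1, but if some proper
    initial segment is uncountable, then the hypothesis lets the continuum be
    embedded in the shortest such segment. *)
Lemma continuum_omega1_order : continuum_hypothesis ->
  exists lt : set nat -> set nat -> Prop, omega1_order lt.
Proof.
move=> [ucM minM].
have [R woR] := well_ordering_principle (set nat).
pose lt0 a b := R a b /\ a <> b.
have Rleast (P : set (set nat)) : P !=set0 ->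
    exists2 m, P m & forall b, P b -> R m b.
  move=> [p Pp]; have [|m [[mP lbm] _]] := woR [pred x | `[< P x >]].
    by exists p; rewrite inE.
  exists m; first by move: mP; rewrite inE.
  by move=> b Pb; apply: lbm; rewrite inE.
have Runiq a b : R a b -> R b a -> a = b.
  move=> Rab Rba.
  have [|m [_ mu]] := woR [pred x | (x == a) || (x == b)].
    by exists a; rewrite inE eqxx.
  have Raa : R a a.
    by have [|c -> /(_ a erefl)] := Rleast [set a]; first by exists a.
  have Rbb : R b b.
    by have [|c -> /(_ b erefl)] := Rleast [set b]; first by exists b.
  rewrite -(mu a); last first.
    split; first by rewrite inE eqxx.
    by move=> c; rewrite inE => /orP[/eqP->|/eqP->].
  apply: mu; split; first by rewrite inE eqxx orbT.
  by move=> c; rewrite inE => /orP[/eqP->|/eqP->].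
have Rtot a b : R a b \/ R b a.
  have [|c [->|->] cl] := Rleast [set x | x = a \/ x = b].
  - by exists a; left.
  - by left; apply: cl; right.
  - by right; apply: cl; left.
have Rtrans a b c : R a b -> R b c -> R a c.
  move=> Rab Rbc.
  have [|d [->|[->|->]] dl] := Rleast [set x | x = a \/ x = b \/ x = c].
  - by exists a; left.
  - by apply: dl; right; right.
  - by rewrite (Runiq a b) //; apply: dl; left.
  - by rewrite -(Runiq b c) //; apply: dl; right; left.
have main (f : set nat -> set nat) : injective f ->
    (forall a, countable [set b | lt0 b (f a)]) ->
    omega1_order (fun a b => lt0 (f a) (f b)).
  move=> injf cseg; split => //.
  - move=> a b c [Rab nab] [Rbc nbc]; split; first exact: Rtrans Rab Rbc.
    by move=> ac; apply: nab; apply: Runiq => //; rewrite ac.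
  - move=> a b; have [ab|nab] := pselect (a = b); first by right; left.
    have nf : f a <> f b by move/injf.
    have [Rab|Rba] := Rtot (f a) (f b); first by left; split.
    by right; right; split => // e; exact: nf.
  - move=> P [p Pp]; have [|m [q Pq <-] ml] := Rleast (f @` P).
      by exists (f p); exists p.
    exists q => // b Pb [Rbq nbq]; apply: nbq; apply: Runiq => //.
    by apply: ml; exists b.
  - move=> a; apply: (@countable_inj _ _ f).
      by move=> x y _ _; exact: injf.
    by apply: sub_countable_set (cseg a) => _ [b ba <-].
have [allc|] := pselect (forall a, countable [set b | lt0 b a]).
  exists (fun a b => lt0 (id a) (id b)).
  by apply: main => // a; exact: allc.
move=> /existsNP[a0 uca0].
have [|p ucp pl] := Rleast [set a | ~ countable [set b | lt0 b a]].
  by exists a0.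
have /card_leP[f] := minM _ [set b | lt0 b p] ucp.
pose emb a : [set: set nat] := SigSub (mem_set (I : [set: set nat] a)).
pose h a : set nat := \val (f (emb a)).
have fp a : lt0 (h a) p by exact: set_mem (valP (f (emb a))).
exists (fun a b => lt0 (h a) (h b)); apply: main.
  by move=> x y /val_inj/(@inj _ _ _ f); rewrite !inE => /(_ I I)/(congr1 \val).
move=> a; apply: contrapT => uc; have [Rap nap] := fp a.
by apply: nap; apply: Runiq => //; exact: pl.
Qed.

(** * Sets on which uncountably many points concentrate *)

Section InitialCube.
Variables (S K : choiceType) (f : S -> cube K).
Local Notation Y := (initial_topology f).

Lemma initial_cube_coordinate k (y : Y) : nbhs y [set y' | f y' k = f y k].
Proof. exact: (@initial_continuous _ _ f y _ (nbhs_coordinate k (f y))). Qed.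

Lemma initial_cube_nbhs (y : Y) (A : set Y) : nbhs y A ->
  exists F : seq K, [set y' | agree [set` F] (f y) (f y')] `<=` A.
Proof.
rewrite nbhsE => -[B [[O oO <-] Oy] BA].
have /nbhs_cyl[F FO] : nbhs (f y) O by exact: open_nbhs_nbhs.
by exists F => y' /FO/BA.
Qed.

Lemma initial_cube_regular : regular_space Y.
Proof. exact: uniform_regular. Qed.

Lemma initial_cube_accessible : injective f -> accessible_space Y.
Proof.
move=> injf y y' /eqP neq.
have /existsNP[k /eqP fk] : ~ forall k, f y k = f y' k.
  by move=> e; apply: neq; apply: injf; apply: funext.
exists (f @^-1` [set a | a k = f y k]); split; rewrite ?inE //=.
  exists [set a | a k = f y k] => //; rewrite openE => a /= <-.
  exact: nbhs_coordinate.
by move=> e; move: fk; rewrite e eqxx.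
Qed.

End InitialCube.

Definition productively_lindelof_in (I : choiceType) (X : set (cube I)) : Prop :=
  forall Y : topologicalType, lindelof Y ->
    lindelof_in (X `*` [set: Y] : set (cube I * Y)).

Section Concentration.
Variables (I M : choiceType) (lt : M -> M -> Prop).
Hypothesis omega1M : omega1_order lt.
Variables (X Z : set (cube I)) (G : M -> set (cube I)) (x : M -> cube I).

(* The M-coordinates isolate the points x m, and vanish on Z. *)
Let f (s : M + set_type Z) : cube (I + M)%type :=
  match s with
  | inl m => fun k => match k with inl i => x m i | inr m' => m' == m end
  | inr z => fun k => match k with inl i => \val z i | inr _ => false end
  end.

Let f_inj : injective f.
Proof.
move=> [m|z] [m'|z'] e.
- have := congr1 (fun a : cube _ => a (inr m)) e.
  by rewrite /= eqxx => /esym/eqP ->.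
- by have := congr1 (fun a : cube _ => a (inr m)) e; rewrite /= eqxx.
- by have := congr1 (fun a : cube _ => a (inr m')) e; rewrite /= eqxx.
- congr inr; apply: val_inj; apply: funext => i.
  exact: (congr1 (fun a : cube _ => a (inl i)) e).
Qed.

Let Y : topologicalType := initial_topology f.

Hypothesis concentrated : forall O, (forall z, Z z -> nbhs z (O z)) ->
  exists Q g, [/\ Q `<=` Z, countable Q, Z `<=` \bigcup_(q in Q) O q &
    forall a, ~ (\bigcup_(q in Q) O q) a -> exists2 b, lt b g & G b a].

Hypothesis x_late : forall b m, lt b m -> ~ G b (x m).

(** Neighbourhoods of the points of [Z] restrict finitely many coordinates in
    [M], so each of them excludes only finitely many isolated points beyond those
    that its trace on the cube of [I] misses. *)
Let lindelofY : lindelof Y.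
Proof.
apply: lindelof_in_lindelof.
- exact: initial_cube_accessible.
- exact: initial_cube_regular.
move=> O nO.
have /choice[F FP] : forall z : cube I, exists F : seq (I + M),
    forall Zz : z \in Z,
      [set y | agree [set` F] (f (inr (SigSub Zz))) (f y)] `<=` O (inr (SigSub Zz)).
  move=> z; have [Zz|nZz] := pselect (z \in Z); last first.
    by exists [::] => Zz; case: (nZz Zz).
  have [F FO] := initial_cube_nbhs (nO (inr (SigSub Zz)) Logic.I).
  by exists F => Zz'; rewrite (bool_irrelevance Zz' Zz).
pose FI z : seq I := pmap (fun k => if k is inl i then Some i else None) (F z).
have FIP z i : (i \in FI z) = (inl i \in F z).
  rewrite mem_pmap; apply/mapP/idP => [[[j|m] kF //= [->]]//|iF].
  by exists (inl i).
have [z _|Q [g [QZ cQ Qcov Qout]]] := @concentrated (fun z => cyl (FI z) z).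
  exact: cyl_nbhs.
pose D : set M := [set b | lt b g] `|` [set g] `|`
  [set m | exists2 z, Q z & inr m \in F z].
pose R : set Y := (fun m => inl m) @` D `|`
  [set y | exists z (Zz : z \in Z), Q z /\ y = inr (SigSub Zz)].
exists R; split => //.
- apply: countable_setU.
    apply: countable_image; apply: countable_setU; first apply: countable_setU.
    - by case: omega1M => _ _ _ + _; exact.
    - exact: countable1.
    - have -> : [set m | exists2 z, Q z & inr m \in F z] =
          \bigcup_(z in Q) [set m | inr m \in F z] by [].
      apply: bigcup_countable => // z _.
      apply: (@countable_inj _ _ (@inr I M)); first by move=> ? ? _ _ [].
      apply: sub_countable_set (finite_set_countable (finite_seq (F z))).
      by move=> _ [m mF <-].
  apply: (@countable_inj _ _ f); first by move=> ? ? _ _; exact: f_inj.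
  pose g0 (z : cube I) : cube (I + M)%type :=
    fun k => match k with inl i => z i | inr _ => false end.
  apply: sub_countable_set (countable_image g0 cQ).
  by move=> _ [_ [z [Zz [Qz ->]]] <-]; exists z.
- have QO z (Zz : z \in Z) : Q z -> R (inr (SigSub Zz)).
    by move=> Qz; right; exists z, Zz.
  move=> [m|z] _.
  + have [Dm|nDm] := pselect (D m).
      by exists (inl m); [left; exists m|exact: nbhs_singleton (nO (inl m) Logic.I)].
    have gm : lt g m.
      have [_ tot _ _ _] := omega1M; have [//|[gm|mg]] := tot g m.
        by case: nDm; left; right.
      by case: nDm; left; left.
    have [[z Qz zx]|nx] := pselect ((\bigcup_(q in Q) cyl (FI q) q) (x m)).
      have Zz : z \in Z by rewrite inE; exact: QZ.
      exists (inr (SigSub Zz)); first exact: QO.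
      apply: FP => -[i|m'] kF /=; first by apply: zx; rewrite /= FIP.
      apply/esym/eqP => mm'; apply: nDm; right; exists z => //.
      by rewrite -mm'.
    have [b bg Gb] := Qout _ nx; exfalso; apply: (@x_late b m) => //.
    by have [tr _ _ _ _] := omega1M; exact: tr bg gm.
  + have [q Qq qz] := Qcov _ (set_mem (valP z)).
    have Zq : q \in Z by rewrite inE; exact: QZ.
    exists (inr (SigSub Zq)); first exact: QO.
    by apply: FP => -[i|m'] kF //=; apply: qz; rewrite /= FIP.
Qed.

(** A pair [(a, y)] with [a] different from the point [y] of the cube has a
    neighbourhood fixing a coordinate where they differ, which misses the pairs
    [(x m, x m)]. Each of these needs its own isolating neighbourhood, and there
    are uncountably many. *)
Lemma concentrated_not_productively_lindelof :
  (forall m, X (x m)) -> (forall z, Z z -> ~ X z) ->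
  ~ productively_lindelof_in X.
Proof.
move=> Xx ZX prodX.
have nctbl : ~ countable [set: M] by case: omega1M.
have /choice[k kP] : forall p : cube I * Y, exists k : option (I + M), X p.1 ->
    match k with
    | Some (inl i) => p.1 i <> f p.2 (inl i)
    | Some (inr m) => f p.2 (inr m)
    | None => False
    end.
  move=> [a [m|z]]; first by exists (Some (inr m)) => _ /=; rewrite eqxx.
  have [Xa|nXa] := pselect (X a); last by exists None => /nXa.
  have /existsNP[i ai] : ~ forall i, a i = \val z i.
    move=> e; apply: (ZX (\val z)); first exact: set_mem (valP z).
    by rewrite (_ : \val z = a) //; apply: funext => i.
  by exists (Some (inl i)).
pose O (p : cube I * Y) : set (cube I * Y) := [set p' | match k p with
  | Some (inl i) => p'.1 i = p.1 i /\ f p'.2 (inl i) = f p.2 (inl i)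
  | Some (inr m) => f p'.2 (inr m) = f p.2 (inr m)
  | None => False
  end].
have [[a y] [/= Xa _]|Q [QX cQ Qcov]] := prodX Y lindelofY O.
  have := kP (a, y) Xa; rewrite /O; case: (k (a, y)) => [[i|m]|] //= _.
    exists ([set a' | a' i = a i], [set y' | f y' (inl i) = f y (inl i)]) => //=.
    by split; [exact: nbhs_coordinate|exact: initial_cube_coordinate].
  exists (setT, [set y' | f y' (inr m) = f y (inr m)]) => /=.
    by split; [exact: filterT|exact: initial_cube_coordinate].
  by move=> [a' y'] [].
have /existsNP[m nm] : ~ forall m, (k @` Q) (Some (inr m)).
  move=> kQ; apply: nctbl; apply: (@countable_inj _ _ (Some \o @inr I M)).
    by move=> ? ? _ _ [].
  by apply: sub_countable_set (countable_image k cQ) => _ [m _ <-]; exact: kQ.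
have [[a y] Qay] := Qcov (x m, inl m) (conj (Xx m) Logic.I).
have := kP _ (QX _ Qay).1; rewrite /O /=.
case kay : (k (a, y)) => [[i|m']|] //= => [ay [xa xy]|ym].
  by apply: ay; rewrite -xa -xy.
rewrite ym => /eqP mm'; apply: nm; exists (a, y) => //.
by rewrite kay mm'.
Qed.

End Concentration.

(** * Sets depending on countably many coordinates *)

Section SaturatedSets.
Variable I : choiceType.
Implicit Types (J : set I) (F : seq I) (a b c : cube I) (S C K : set (cube I)).

Lemma saturatedC J S : saturated J S -> saturated J (~` S).
Proof. by move=> sS a b ab nSa Sb; apply: nSa; apply: sS Sb; exact: agree_sym. Qed.

Lemma saturatedU J (A : Type) (D : set A) (S : A -> set (cube I)) :
  (forall d, D d -> saturated J (S d)) -> saturated J (\bigcup_(d in D) S d).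
Proof. by move=> sS a b ab [d Dd Sa]; exists d => //; exact: sS Sa. Qed.

Lemma closed_cylC a S : closed S -> ~ S a -> exists F, cyl F a `<=` ~` S.
Proof.
move=> clS nSa; apply: nbhs_cyl; apply: open_nbhs_nbhs.
by split => //; exact: closed_openC.
Qed.

(** The closed sets depending on countably many coordinates, listed by the
    binary words forbidden along a sequence of coordinates. *)
Definition forbid (e : (nat -> I) * set (seq bool)) : set (cube I) :=
  [set a | forall n, ~ e.2 [seq a (e.1 k) | k <- iota 0 n]].

Lemma closed_saturated_forbid (i0 : I) J S :
  countable J -> closed S -> saturated J S -> range forbid S.
Proof.
move=> /countable_injP[g injg] clS sS.
have /choice[e eP] : forall n, exists i, forall i', J i' -> g i' = n -> i = i'.
  move=> n; have [[i [Ji gi]]|ni] := pselect (exists i, J i /\ g i = n).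
    exists i => i' Ji' gi'; apply: injg; rewrite ?inE //; congruence.
  by exists i0 => i' Ji' gi'; case: ni; exists i'.
pose W := [set w : seq bool | forall c, S c ->
  w <> [seq c (e k) | k <- iota 0 (size w)]].
exists (e, W) => //; rewrite eqEsubset; split=> a.
  move=> Wa; apply: contrapT => nSa.
  have [|F [FJ nac]] := @closed_separation _ J S a clS.
    by move=> c Sc ac; apply: nSa; apply: sS Sc; exact: agree_sym.
  pose n := (\max_(i <- F) (g i).+1)%N.
  apply: (Wa n) => c Sc /=; rewrite size_map size_iota => /eq_in_map ac.
  apply: (nac c Sc) => i iF.
  have -> : i = e (g i) by apply/esym/eP => //; exact: FJ.
  apply: ac; rewrite mem_iota /= add0n.
  by apply: (@leq_bigmax_seq _ _ _ (fun i => (g i).+1) i).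
move=> Sa n /= Wn; apply: (Wn a Sa).
by rewrite size_map size_iota.
Qed.

Lemma countable_cylinders J : countable J ->
  countable [set V | exists F c, (forall i, i \in F -> J i) /\ V = cyl F c].
Proof.
move=> /countable_injP[g injg].
(* the partial function with graph w, its coordinates coded by g *)
pose f (w : seq (nat * bool)) : set (cube I) :=
  [set b | forall i v, J i -> (g i, v) \in w -> b i = v].
apply: sub_countable_set (countable_image f (countableP setT)) => V.
move=> [F [c [FJ ->]]]; exists [seq (g i, c i) | i <- F] => //.
rewrite eqEsubset; split=> b.
  by move=> fb i iF; apply/esym/fb; [exact: FJ|apply: map_f].
move=> cb i v Ji /mapP[k kF [gik ->]].
have -> : i = k by apply: injg; rewrite ?inE //; exact: FJ.
by rewrite cb.
Qed.

(** The Baire category theorem for compact [K]. The sets covering [K] depend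
    on the coordinates of [J], and so do the cylinders chosen to escape from
    them one after the other. *)
Lemma baire_cylinder J K (H : set (set (cube I))) : closed K -> K !=set0 ->
  countable H -> (forall S, H S -> closed S /\ saturated J S) ->
  K `<=` \bigcup_(S in H) S ->
  exists F c S, [/\ forall i, i \in F -> J i, K c, H S & cyl F c `&` K `<=` S].
Proof.
move=> clK [c0 Kc0] /countable_injP[g injg] clH Kcov; apply: contrapT => nex.
(* the n-th step escapes from the set of the family with code n *)
have step n : forall s : seq I * cube I, exists s' : seq I * cube I,
    (forall i, i \in s.1 -> J i) -> K s.2 ->
    [/\ forall i, i \in s'.1 -> J i, {subset s.1 <= s'.1}, K s'.2,
        cyl s.1 s.2 s'.2 &
        forall S, H S -> g S = n -> cyl s'.1 s'.2 `&` S = set0].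
  move=> [F c] /=.
  have [[FJ Kc]|nFK] := pselect ((forall i, i \in F -> J i) /\ K c); last first.
    by exists (F, c) => FJ Kc; case: nFK.
  have [[S [HS gS]]|nS] := pselect (exists S, H S /\ g S = n); last first.
    by exists (F, c) => _ _; split => // S HS gS; case: nS; exists S.
  have /existsNP[c' /not_implyP[[cc' Kc'] nSc']] :
      ~ (cyl F c `&` K `<=` S).
    by move=> sub; apply: nex; exists F, c, S.
  have [clS sS] := clH S HS.
  have [|F' [F'J nF']] := @closed_separation _ J S c' clS.
    by move=> d Sd c'd; apply: nSc'; apply: sS Sd; exact: agree_sym.
  exists (F ++ F', c') => _ _; split => //=.
  - by move=> i; rewrite mem_cat => /orP[/FJ|/F'J].
  - by move=> i iF; rewrite mem_cat iF.
  - move=> S' HS' gS'; have -> : S' = S by apply: injg; rewrite ?inE //; congruence.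
    rewrite -subset0 => d [c'd Sd]; apply: (nF' d Sd) => i iF'; apply: c'd.
    by rewrite /= mem_cat iF' orbT.
have /choice[nxt nxtP] : forall ns : nat * (seq I * cube I), exists s',
    (forall i, i \in ns.2.1 -> J i) -> K ns.2.2 ->
    [/\ forall i, i \in s'.1 -> J i, {subset ns.2.1 <= s'.1}, K s'.2,
        cyl ns.2.1 ns.2.2 s'.2 &
        forall S, H S -> g S = ns.1 -> cyl s'.1 s'.2 `&` S = set0].
  by move=> [n s]; exact: step.
pose s := fix s n := if n is n'.+1 then nxt (n', s n') else ([::], c0).
have sJK n : (forall i, i \in (s n).1 -> J i) /\ K (s n).2.
  elim: n => [|n [sJ sK]]; first by split.
  by have [] := nxtP (n, s n) sJ sK.
have sS n : [/\ {subset (s n).1 <= (s n.+1).1}, cyl (s n).1 (s n).2 (s n.+1).2 &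
    forall S, H S -> g S = n -> cyl (s n.+1).1 (s n.+1).2 `&` S = set0].
  by have [sJ sK] := sJK n; have [] := nxtP (n, s n) sJ sK.
have mono n k : {subset (s n).1 <= (s (n + k)).1} /\
    cyl (s n).1 (s n).2 (s (n + k)).2.
  elim: k => [|k [IHs IHc]]; first by rewrite addn0; split.
  rewrite addnS; have [ss sc _] := sS (n + k); split.
    by move=> i /IHs/ss.
  apply: agree_trans IHc _; apply: agreeS sc => i; exact: IHs.
have [p Kp pP] : exists2 p, K p & forall n, cyl (s n).1 (s n).2 p.
  apply: contrapT => np.
  have /choice[k kP] : forall p, exists n, K p -> ~ cyl (s n).1 (s n).2 p.
    move=> p; have [Kp|nKp] := pselect (K p); last by exists 0%N => /nKp.
    have /existsNP[n nc] : ~ forall n, cyl (s n).1 (s n).2 p.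
      by move=> all_; apply: np; exists p.
    by exists n.
  have [p Kp|F [FK Fcov]] := compact_finite_subcover
      (O := fun p => ~` cyl (s (k p)).1 (s (k p)).2) (closed_compact_cube clK).
    apply: open_nbhs_nbhs; split; last exact: kP.
    exact/closed_openC/cyl_closed.
  pose N := (\max_(p <- F) k p)%N.
  have [p pF] := Fcov (s N).2 (sJK N).2; apply.
  have /subnKC <- : (k p <= N)%N by exact: (@leq_bigmax_seq _ _ _ k p).
  by have [] := mono (k p) (N - k p)%N.
have [S HS Sp] := Kcov p Kp; have [_ _ /(_ S HS erefl)] := sS (g S).
by rewrite -subset0; apply; split; first exact: (pP (g S).+1).
Qed.

End SaturatedSets.

(** * Sigma-compact projections *)

Section SmallWeight.
Variables (I : choiceType) (M : choiceType) (lt : M -> M -> Prop).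
Hypothesis omega1M : omega1_order lt.
Implicit Types (J : set I) (F : seq I) (a b c : cube I) (S C K : set (cube I)).


Lemma omega1_bounded2 (g h : M) : exists m, lt g m /\ lt h m.
Proof.
have [|m mP] := omega1_order_bounded (Q := [set g; h]) omega1M.
  exact/finite_set_countable/finite_set2.
by exists m; split; apply: mP; [left|right].
Qed.

(** Each point outside the saturation of the intersection has a neighbourhood that
    some [C m] misses, by compactness. The complement of the saturation is Lindelof,
    so countably many of these neighbourhoods cover it, and one stage comes after
    all their indices. *)
Lemma decreasing_closed_stable J (C : M -> set (cube I)) : countable J ->
  (forall m, closed (C m)) -> (forall m n, lt m n -> C n `<=` C m) ->
  exists m, C m `<=` sat J (\bigcap_n C n).
Proof.
move=> cJ clC decC; set D := \bigcap_n C n.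
have clD : closed D by apply: closed_bigI => m _.
have /choice[FM FMP] : forall a, exists Fm : seq I * M,
    ~ sat J D a -> cyl Fm.1 a `&` C Fm.2 = set0.
  move=> a; have [m0 _] : exists m : M, True.
    apply: contrapT => nM; have [_ _ _ _] := omega1M; apply.
    suff -> : [set: M] = set0 by exact: countable0.
    by rewrite -subset0 => m _; apply: nM; exists m.
  have [sa|nsa] := pselect (sat J D a); first by exists ([::], m0) => /(_ sa).
  have [F FD] : exists F, cyl F a `<=` ~` D.
    by apply: closed_cylC => // Da; apply: nsa; exact: sub_sat.
  have /choice[k kP] : forall b, exists m, cyl F a b -> ~ C m b.
    move=> b; have [ab|nab] := pselect (cyl F a b); last by exists m0 => /nab.
    have /existsNP[m nCb] : ~ forall m, C m b.
      by move=> Cb; apply: (FD b ab) => m _; exact: Cb.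
    by exists m.
  have [b ab|E [EF Ecov]] := compact_finite_subcover (O := fun b => ~` C (k b))
      (closed_compact_cube (@cyl_closed _ F a)).
    by apply: open_nbhs_nbhs; split; [exact: closed_openC|exact: kP].
  have [|m mP] := omega1_order_bounded (Q := k @` [set` E]) omega1M.
    exact/countable_image/finite_set_countable/finite_seq.
  exists (F, m) => _; rewrite -subset0 => b [/Ecov[d dE]] nCb Cb.
  by apply: nCb; apply: decC Cb; apply: mP; exists d.
have [a _|Q [QS cQ Qcov]] := lindelof_in_saturated
    (O := fun a => cyl (FM a).1 a) cJ (saturatedC (@sat_saturated _ J D)).
  exact: cyl_nbhs.
have [|m mP] := omega1_order_bounded (Q := (fun a => (FM a).2) @` Q) omega1M.
  exact: countable_image.
exists m => a Ca; apply: contrapT => /Qcov[q Qq qa].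
have := FMP q (QS q Qq); rewrite -subset0; apply; split; first exact: qa.
by apply: decC Ca; apply: mP; exists q.
Qed.

End SmallWeight.

Section SigmaCompact.
Variables (I : choiceType) (lt : set nat -> set nat -> Prop).
Hypothesis omega1M : omega1_order lt.
Hypothesis sizeI : continuum_sized I.

(** Were the projection of [X] to the coordinates [J] not sigma-compact, one could
    choose points of [X] escaping, one after the other, all compact subsets of
    that projection. They concentrate on the complement of the saturation,
    which is Lindelof because only [J] matters. *)
Lemma sigma_compact_projection (X : set (cube I)) (J : set I) (i0 : I) :
  productively_lindelof_in X -> countable J ->
  exists H : set (set (cube I)),
    [/\ countable H, sat J X `<=` \bigcup_(S in H) S &
        forall S, H S -> [/\ closed S, saturated J S & S `<=` sat J X]].
Proof.
move=> prodX cJ; apply: contrapT => nH.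
pose D : set (set (cube I)) :=
  [set S | [/\ closed S, saturated J S & S `<=` sat J X]].
have D0 : D set0 by split => //; exact: closed0.
have [G [GD Gall]] := continuum_enumeration (f := @forbid I) (D := D) (d0 := set0)
  (continuum_sized_prod (continuum_sized_seq sizeI) (continuum_sized_set _))
  (fun S '(And3 cl sa _) => closed_saturated_forbid i0 cJ cl sa) D0.
have /choice[x xP] : forall m, exists x, X x /\ forall b, lt b m -> ~ G b x.
  move=> m; apply: contrapT => nx; apply: nH.
  exists (G @` [set b | lt b m]); split.
  - by apply: countable_image; case: omega1M => _ _ _ + _; exact.
  - move=> a [x Xx ax]; apply: contrapT => na; apply: nx; exists x; split => // b bm Gx.
    apply: na; exists (G b); first by exists b.
    by have [_ sG _] := GD b; apply: sG Gx; exact: agree_sym.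
  - by move=> _ [b _ <-]; exact: GD.
apply: (@concentrated_not_productively_lindelof I _ lt omega1M X (~` sat J X) G x) => //.
- move=> O nO.
  have [a Za|Q [QZ cQ Qcov]] := lindelof_in_saturated (O := fun a => (O a)°) cJ
      (saturatedC (@sat_saturated _ J X)); first exact/nbhs_interior/nO.
  pose C := ~` \bigcup_(q in Q) (O q)°.
  have clC : closed C.
    by apply: open_closedC; apply: bigcup_open => q _; exact: open_interior.
  have CX : C `<=` sat J X by move=> a Ca; apply: contrapT => /Qcov.
  have [|m Gm] := Gall (sat J C).
    split; [exact: sat_closed|exact: sat_saturated|].
    by move=> a /(satS CX)/saturated_sat; apply; exact: sat_saturated.
  (* the compact set left uncovered by Q is contained in a listed one, G m *)
  have [g [mg _]] := omega1_bounded2 omega1M m m.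
  exists Q, g; split => //.
    by move=> a /Qcov[q Qq qa]; exists q => //; exact: interior_subset.
  move=> a na; exists m => //; rewrite Gm; apply: sub_sat.
  by move=> [q Qq qa]; apply: na; exists q => //; exact: interior_subset.
- by move=> b m bm; have [_ +] := xP m; exact.
- by move=> m; have [] := xP m.
- by move=> z nz Xz; apply: nz; exact: sub_sat.
Qed.

End SigmaCompact.

(** * Alster's theorem *)

Section Alster.
Variables (I : choiceType) (lt : set nat -> set nat -> Prop).
Hypothesis omega1M : omega1_order lt.
Hypothesis sizeI : continuum_sized I.
Variables (i0 : I) (X : set (cube I)).
Hypothesis prodX : productively_lindelof_in X.
Local Notation M := (set nat).
Implicit Types (F : seq I) (a b c : cube I) (C : set (cube I)).

Let ltT (k m n : M) : lt k m -> lt m n -> lt k n.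
Proof. by case: omega1M => + _ _ _ _; apply. Qed.

Let cseg (m : M) : countable [set b | lt b m].
Proof. by case: omega1M => _ _ _ + _; exact. Qed.

Let bounded (Q : set M) : countable Q -> exists g, forall q, Q q -> lt q g.
Proof. exact: omega1_order_bounded. Qed.

Let lindelofX : lindelof_in X.
Proof.
have -> : X = fst @` (X `*` [set: bool]).
  rewrite eqEsubset; split=> [a Xa|_ [[a b] [Xa _] <- //]].
  by exists (a, true).
apply: lindelof_in_image (prodX lindelof_bool) => p; exact: cvg_fst.
Qed.

Variables (G : M -> set (cube I)) (j : M -> set I).
Hypothesis G_closed : forall m, closed (G m).
Hypothesis G_saturated : forall m, saturated (j m) (G m).
Hypothesis j_countable : forall m, countable (j m).
Hypothesis j_cover : forall i, exists m, j m i.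

Let J m : set I := \bigcup_(b in [set b | lt b m]) j b.

Let J_countable m : countable (J m).
Proof. exact: bigcup_countable. Qed.

Let J_mono m n : lt m n -> J m `<=` J n.
Proof. by move=> mn i [b bm jb]; exists b => //; exact: ltT mn. Qed.

Let GJ (b m : M) : lt b m -> saturated (J m) (G b).
Proof. by move=> bm; apply: saturatedS (@G_saturated b) => i ji; exists b. Qed.

Let coverable C := exists2 Q : set M, countable Q & C `<=` \bigcup_(m in Q) G m.

Let coverableS C C' : C `<=` C' -> coverable C' -> coverable C.
Proof. by move=> CC' [Q cQ C'Q]; exists Q => // a /CC'/C'Q. Qed.

Let coverable_bigcup (A : Type) (D : set A) (C : A -> set (cube I)) :
  countable D -> (forall d, D d -> coverable (C d)) ->
  coverable (\bigcup_(d in D) C d).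
Proof.
move=> cD cC.
have /choice[Q QP] : forall d, exists Q : set M, D d ->
    countable Q /\ C d `<=` \bigcup_(m in Q) G m.
  move=> d; have [Dd|nDd] := pselect (D d); last by exists set0 => /nDd.
  by have [Q cQ CQ] := cC d Dd; exists Q.
exists (\bigcup_(d in D) Q d).
  by apply: bigcup_countable => // d /QP[].
move=> a [d Dd Ca]; have [_ /(_ a Ca)[m Qm Gm]] := QP d Dd.
by exists m => //; exists d.
Qed.

(* Stage m depends on the countable set J m only, so it is Lindelof. Removing the
   earlier G b ensures that each G b meets no stage after b. *)
Let Z m : set (cube I) := ~` sat (J m) X `&` ~` \bigcup_(b in [set b | lt b m]) G b.

Let Zall : set (cube I) := \bigcup_m Z m.

Let Z_lindelof m : lindelof_in (Z m).
Proof.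
apply: lindelof_in_saturated (J_countable m) _ => a b ab [nX nG]; split.
  exact: saturatedC (@sat_saturated _ _ _) _ _ ab nX.
apply: saturatedC ab nG; apply: saturatedU => d; exact: GJ.
Qed.

Let outside_sat a : ~ X a -> exists m, ~ sat (J m) X a.
Proof.
move=> nXa.
have /choice[k kP] : forall x, exists o : option I, X x ->
    exists i, o = Some i /\ a i <> x i.
  move=> x; have [Xx|nXx] := pselect (X x); last by exists None => /nXx.
  have /existsNP[i axi] : ~ forall i, a i = x i.
    by move=> ax; apply: nXa; rewrite (_ : a = x) //; exact: funext.
  by exists (Some i) => _; exists i.
have [x Xx|Q [QX cQ Qcov]] := lindelofX
    (O := fun x => [set b | forall i, k x = Some i -> b i = x i]).
  have [i [-> _]] := kP x Xx.
  by apply: filterS (nbhs_coordinate i x) => b bi _ [<-].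
have /choice[h hP] := j_cover.
have /choice[hk hkP] : forall x, exists m, forall i, k x = Some i -> j m i.
  move=> x; case kx : (k x) => [i|]; last by exists set0.
  by exists (h i) => _ [<-].
have [m mP] := bounded (countable_image hk cQ).
exists m => -[x Xx ax]; have [q Qq xq] := Qcov x Xx.
have [i [kq aqi]] := kP q (QX q Qq).
apply: aqi; rewrite -(xq i kq); apply: ax; exists (hk q); last exact: hkP.
by apply: mP; exists q.
Qed.

Hypothesis compact_covered :
  forall D, closed D -> D `<=` X -> exists m, D `<=` G m.

(** In the kernel [K], which remains after deleting the relatively open coverable
    pieces of [C], each [G m] is nowhere dense. Hence no cylinder that meets [K]
    has its trace on [K] inside [X], as that trace would be a compact subset of
    [X]; and a stage [dl V] sees this for the cylinder [V]. Let the stage [g] be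
    closed under [dl]. Since [C] misses [Z g], the sets [G b] with [b] before [g],
    together with the closed pieces of the projection of [X] to [J g], cover [K].
    By Baire category one of them contains the trace of a cylinder over [J g]. It
    is not a [G b], so the trace lies in the projection of [X], although a stage
    before [g] sees that it does not. *)
Let avoiding_coverable C : closed C -> (forall a, C a -> ~ Zall a) -> coverable C.
Proof.
move=> clC CZ; apply: contrapT => ncC.
pose K := [set c | C c /\ forall F, ~ coverable (cyl F c `&` C)].
have clK : closed K.
  move=> c clKc; split.
    by apply: clC; apply: closureS clKc => d [].
  move=> F covF; have [d [[Cd nd] cd]] := clKc _ (cyl_nbhs F c).
  apply: (nd F); apply: coverableS covF => e [de Ce]; split => //.
  exact: agree_trans cd de.
have off_kernel D : closed D -> D `<=` C -> D `&` K = set0 -> coverable D.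
  move=> clD DC DK.
  have /choice[F FP] : forall d, exists F, D d -> coverable (cyl F d `&` C).
    move=> d; have [Dd|nDd] := pselect (D d); last by exists [::] => /nDd.
    apply: contrapT => nF.
    have : (D `&` K) d.
      split => //; split; first exact: DC.
      by move=> F cF; apply: nF; exists F.
    by rewrite DK.
  have [d Dd|E [ED Ecov]] := compact_finite_subcover (O := fun d => cyl (F d) d)
      (closed_compact_cube clD); first exact: cyl_nbhs.
  apply: (@coverableS _ (\bigcup_(d in [set` E]) (cyl (F d) d `&` C))).
    by move=> a Da; have [d dE da] := Ecov a Da; exists d => //; split => //; exact: DC.
  apply: coverable_bigcup => [|d /ED Dd]; last exact: FP.
  exact/finite_set_countable/finite_seq.
have K0 : K !=set0.
  apply/set0P/eqP => K0; apply: ncC; apply: off_kernel => //.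
  by rewrite K0 setI0.
have nowhere_dense F c m : K c -> ~ (cyl F c `&` K `<=` G m).
  move=> [Cc nc] sub; apply: (nc F).
  have /choice[H HP] : forall a, exists F, ~ G m a -> cyl F a `<=` ~` G m.
    move=> a; have [Ga|nGa] := pselect (G m a); first by exists [::] => /(_ Ga).
    by have [H HG] := closed_cylC (@G_closed m) nGa; exists H.
  have [a _|Q [QG cQ Qcov]] := lindelof_in_saturated (O := fun a => cyl (H a) a)
      (j_countable m) (saturatedC (@G_saturated m)); first exact: cyl_nbhs.
  apply: (@coverableS _ ((cyl F c `&` C `&` G m) `|`
      \bigcup_(q in Q) (cyl F c `&` C `&` cyl (H q) q))).
    move=> a [ca Ca]; have [Ga|/Qcov[q Qq qa]] := pselect (G m a); first by left.
    by right; exists q.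
  have [Q1 cQ1 Q1cov] : coverable (\bigcup_(q in Q) (cyl F c `&` C `&` cyl (H q) q)).
    apply: coverable_bigcup => // q /QG nGq; apply: off_kernel.
    - by apply: closedI; [apply: closedI => //|]; exact: cyl_closed.
    - by move=> a [[]].
    - rewrite -subset0 => a [[[ca Ca] qa] Ka].
      by apply: (HP q nGq a qa); apply: sub.
  exists ([set m] `|` Q1); first exact: countable_setU (countable1 m) cQ1.
  move=> a [[_ Ga]|/Q1cov[q Qq Gq]]; first by exists m; [left|].
  by exists q; [right|].
have /choice[dl dlP] : forall V : set (cube I), exists m, forall F c,
    V = cyl F c -> K c -> ~ (V `&` K `<=` sat (J m) X).
  move=> V; have [[[F c] [/= VE Kc]]|nV] :=
    pselect (exists Fc : seq I * cube I, V = cyl Fc.1 Fc.2 /\ K Fc.2); last first.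
    by exists set0 => F c VE Kc; case: nV; exists (F, c).
  have /existsNP[a /not_implyP[Va nXa]] : ~ (V `&` K `<=` X).
    move=> VX; have [|m Gm] := compact_covered _ VX.
      by apply: closedI => //; rewrite VE; exact: cyl_closed.
    by apply: (nowhere_dense F c m Kc); rewrite -VE.
  have [m nm] := outside_sat nXa.
  by exists m => _ _ _ _ /(_ a Va).
have /choice[nxt nxtP] : forall g : M, exists h, lt g h /\ forall F c,
    (forall i, i \in F -> J g i) -> lt (dl (cyl F c)) h.
  move=> g.
  have [h hP] := bounded (countable_image dl (countable_cylinders (J_countable g))).
  have [h' [gh' hh']] := omega1_bounded2 omega1M g h.
  exists h'; split => // F c FJ; apply: ltT hh'; apply: hP.
  by exists (cyl F c) => //; exists F, c.
(* g is the supremum of an omega-sequence of stages, each bounding the witnesses for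
   the cylinders over the coordinates of the previous one *)
pose s n := iter n nxt set0.
have s_lt n : lt (s n) (s n.+1) by have [] := nxtP (s n).
have [g gs gleast] : exists2 g, forall n, lt (s n) g &
    forall b : M, (forall n, lt (s n) b) -> ~ lt b g.
  have [_ _ least _ _] := omega1M.
  have [|g gP gl] := least [set g | forall n, lt (s n) g]; last by exists g.
  have [g gP] := bounded (countable_image s (countableP [set: nat])).
  by exists g => n; apply: gP; exists n.
have s_cofinal F : (forall i, i \in F -> J g i) ->
    exists n, forall i, i \in F -> J (s n) i.
  elim: F => [|i F IH] FJ; first by exists 0%N.
  have [k kF|n nF] := IH; first by apply: FJ; rewrite in_cons kF orbT.
  have [b bg jb] := FJ i (mem_head _ _).
  have /existsNP[k nk] : ~ forall k, lt (s k) b by move=> /gleast; apply.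
  have bk : lt b (s k.+1).
    have [_ tot _ _ _] := omega1M; have [//|[<- //|bk]] := tot (s k) b.
    exact: ltT bk (s_lt k).
  have mono m l : J (s m) `<=` J (s (m + l)).
    elim: l => [|l IHl]; first by rewrite addn0.
    by rewrite addnS => x /IHl; apply: J_mono.
  exists (n + k.+1)%N => x; rewrite in_cons => /orP[/eqP->|/nF].
    by rewrite addnC; apply: mono; exists b.
  exact: mono.
have [H [cH Hcov HP]] := sigma_compact_projection omega1M sizeI i0 prodX (J_countable g).
pose H' : set (set (cube I)) := G @` [set b | lt b g] `|` H.
have [|S|a [Ca _]|F [c [S [FJ Kc H'S sub]]]] := @baire_cylinder _ (J g) K H' clK K0.
- exact: countable_setU (countable_image G (cseg g)) cH.
- case=> [[b bg <-]|/HP[] //].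
  by split; [exact: G_closed|exact: GJ].
- have [/Hcov[S HS Sa]|nXa] := pselect (sat (J g) X a).
    by exists S => //; right.
  apply: contrapT => na; apply: (CZ a Ca); exists g => //; split => // -[b bg Gb].
  by apply: na; exists (G b) => //; left; exists b.
case: H'S => [[b _ SE]|/HP[_ _ SX]].
  by apply: (nowhere_dense F c b Kc); rewrite SE.
have [n nF] := s_cofinal F FJ.
apply: (dlP (cyl F c) F c erefl Kc) => a /sub/SX; apply: sat_anti.
apply: (@subset_trans _ (J (s n.+1))); apply: J_mono; last exact: gs.
by have [_] := nxtP (s n); apply.
Qed.

(** If the cover had no countable subcover, points [x m] of [X] could be chosen
    outside all [G b] with [b] before [m], and they concentrate on [Z]. Indeed,
    cover the stages one after the other by countably many neighbourhoods; the
    compact sets [C m] left uncovered decrease to a set missing [Z], hence to a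
    subset of countably many [G b]. These depend on countably many coordinates, so
    by stability they already contain some [C h]. *)
Lemma productively_lindelof_countable_subcover :
  exists2 Q : set M, countable Q & X `<=` \bigcup_(m in Q) G m.
Proof.
apply: contrapT => nX.
have /choice[x xP] : forall m, exists x, X x /\ forall b : M, lt b m -> ~ G b x.
  move=> m; apply: contrapT => nx; apply: nX; exists [set b | lt b m] => //.
  move=> a Xa; apply: contrapT => na; apply: nx; exists a; split => // b bm Gb.
  by apply: na; exists b.
apply: (@concentrated_not_productively_lindelof I _ lt omega1M X Zall G x) => //;
  first last.
- by move=> z [m _ [nz _]] Xz; apply: nz; exact: sub_sat.
- by move=> m; have [] := xP m.
- by move=> b m bm; have [_ +] := xP m; exact.
move=> O nO.
have /choice[Q QP] : forall m, exists Q : set (cube I), [/\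
    Q `<=` Zall, countable Q &
    \bigcup_(b in [set b | lt b m]) Z b `<=` \bigcup_(q in Q) (O q)°].
  move=> m.
  have [|z [b _ Zb]|Q [QZ cQ Qcov]] := @lindelof_in_bigcup _ _
      [set b | lt b m] Z (cseg m) _ (fun z => (O z)°).
  - by move=> b _; exact: Z_lindelof.
  - by apply/nbhs_interior/nO; exists b.
  by exists Q; split => // z /QZ[b _ Zb]; exists b.
pose R m := \bigcup_(b in [set b | lt b m]) Q b.
have cR m : countable (R m) by apply: bigcup_countable => // b _; have [] := QP b.
pose C m := ~` \bigcup_(q in R m) (O q)°.
have clC m : closed (C m).
  by apply: open_closedC; apply: bigcup_open => q _; exact: open_interior.
have decC m n : lt m n -> C n `<=` C m.
  move=> mn a Ca [q [b bm Qq] qa]; apply: Ca; exists q => //; exists b => //.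
  exact: ltT mn.
have [| |P cP Pcov] := @avoiding_coverable (\bigcap_m C m).
- by apply: closed_bigI => m _.
- move=> a Ca [b _ Zb].
  have [m [bm _]] := omega1_bounded2 omega1M b b.
  have [n [mn _]] := omega1_bounded2 omega1M m m.
  apply: (Ca n) => //; have [_ _ Qcov] := QP m.
  have [|q Qq qa] := Qcov a; first by exists b.
  by exists q => //; exists m.
have [g gP] := bounded cP.
have [h hP] := decreasing_closed_stable omega1M (J_countable g) clC decC.
have ChP a : C h a -> exists2 b, lt b g & G b a.
  move=> /hP[d Cd ad]; have [b Pb Gb] := Pcov d Cd.
  exists b; first exact: gP.
  by apply: (GJ (gP b Pb)) Gb; exact: agree_sym.
exists (R h `|` Q g), g; split.
- by move=> z [[b _ Qz]|Qz]; [have [+ _ _] := QP b|have [+ _ _] := QP g]; exact.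
- by apply: countable_setU => //; have [] := QP g.
- move=> z Zz.
  have [[q Rq qz]|nz] := pselect ((\bigcup_(q in R h) (O q)°) z).
    by exists q; [left|exact: interior_subset].
  have [b bg Gb] := ChP z nz; case: Zz => m _ Zm.
  have mg : lt m g.
    have [_ tot _ _ _] := omega1M; have [mb|[->//|bm]] := tot m b.
      exact: ltT mb bg.
    by case: Zm => _ []; exists b.
  have [_ _ Qcov] := QP g; have [|q Qq qz] := Qcov z; first by exists m.
  by exists q; [right|exact: interior_subset].
- move=> a na; apply: ChP => -[q Rq qa]; apply: na.
  by exists q; [left|exact: interior_subset].
Qed.

End Alster.
(** Alster's theorem. Any [J] assigning to each compact [D] a countable set of
    coordinates assigns to [D] a closed G_delta set around it; all such sets are
    listed in type omega_1, each with the coordinates on which it depends. *)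
Theorem alster (I : choiceType) (lt : set nat -> set nat -> Prop) (i0 : I)
    (X : set (cube I)) (J : set (cube I) -> set I) :
  omega1_order lt -> continuum_sized I -> productively_lindelof_in X ->
  (forall D, countable (J D)) ->
  exists Q : set (set (cube I)), [/\ countable Q,
    forall D, Q D -> closed D /\ D `<=` X & X `<=` \bigcup_(D in Q) sat (J D) D].
Proof.
move=> omega1M sizeI prodX cJ; have [k injk] := sizeI.
pose A : set (set (cube I)) :=
  [set S | exists D, [/\ closed D, D `<=` X & S = sat (J D) D]].
have [S [D [clD _ ->]]||G [GA Gall]] := continuum_enumeration (f := @forbid I)
    (D := A) (d0 := sat (J set0) set0)
    (continuum_sized_prod (continuum_sized_seq sizeI) (continuum_sized_set _)).
- exact: closed_saturated_forbid (cJ D) (sat_closed clD) (@sat_saturated _ _ _).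
- by exists set0; split => //; exact: closed0.
have /choice[D DP] := GA.
pose j m : set I := J (D m) `|` [set i | k i = m].
have [||| |E clE EX|Q cQ Qcov] := @productively_lindelof_countable_subcover I lt
    omega1M sizeI i0 X prodX G j.
- by move=> m; have [clD _ ->] := DP m; exact: sat_closed.
- move=> m; have [_ _ ->] := DP m.
  by apply: saturatedS (@sat_saturated _ _ _) => i Ji; left.
- move=> m; apply: countable_setU => //.
  apply: (@countable_inj _ _ k); first by move=> ? ? _ _; exact: injk.
  by apply: sub_countable_set (countable1 m) => _ [i <- <-].
- by move=> i; exists (k i); right.
- have [|m Gm] := Gall (sat (J E) E); first by exists E.
  by exists m; rewrite Gm; exact: sub_sat.
exists (D @` Q); split; first exact: countable_image.
  by move=> _ [m _ <-]; have [] := DP m.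
move=> a /Qcov[m Qm]; have [_ _ ->] := DP m => Da.
by exists (D m) => //; exists m.
Qed.

(** * Countable powers *)

(** The hypotheses abstract Alster's covering property: [C] lists compact sets, and
    [N k] is a filter of sets around [C k], closed under countable intersections
    and containing the open neighbourhoods of [C k]; to select one member of each
    filter is to cover [Y] by countably many of the selected sets. *)
Section CountablePower.
Variables (X : topologicalType) (Y : set X) (K : Type).
Variables (C : K -> set X) (N : K -> set (set X)).
Hypothesis CY : forall k, C k `<=` Y.
Hypothesis C_compact : forall k, compact (C k).
Hypothesis N_open : forall k U, open U -> C k `<=` U -> N k U.
Hypothesis N_bigcap : forall k (Q : set K) (R : K -> set X), countable Q ->
  (forall l, Q l -> N k (R l)) -> N k (\bigcap_(l in Q) R l).
Hypothesis N_select : forall R, (forall k, N k (R k)) ->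
  exists2 Q : set K, countable Q & Y `<=` \bigcup_(k in Q) R k.
Local Notation X_omega := (prod_topology (fun _ : nat => X)).

(** Given a neighbourhood assignment with no countable subcover, coordinates are
    frozen one at a time: [d n] is chosen so that no product of members of the
    filters [N (d i)], [i <= n], is countably covered. If no choice worked, the
    selection principle would produce countably many covered products whose
    [n]-th factors cover [Y]; intersecting their first [n] factors contradicts the
    previous step. In the end the product of the compact sets [C (d i)] is covered
    by finitely many boxes, hence so is a product of finitely many neighbourhoods,
    against the choice of [d]. *)
Lemma lindelof_in_countable_power :
  lindelof_in [set f : X_omega | forall n, Y (f n)].
Proof.
move=> O nO; set P := [set f : X_omega | forall n, Y (f n)].
pose good (A : set X_omega) := exists Q : set X_omega,
  [/\ Q `<=` P, countable Q & A `&` P `<=` \bigcup_(q in Q) O q].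
apply: contrapT => nP.
pose bad n (d : nat -> K) := forall R : nat -> set X,
  (forall i, (i < n)%N -> N (d i) (R i)) ->
  ~ good [set f | forall i, (i < n)%N -> R i (f i)].
have step n d : bad n d -> exists k,
    forall e, (forall i, (i < n)%N -> e i = d i) -> e n = k -> bad n.+1 e.
  move=> bd; apply: contrapT => nk.
  have /choice[R RP] : forall k, exists R : nat -> set X,
      [/\ forall i, (i < n)%N -> N (d i) (R i), N k (R n) &
          good [set f | forall i, (i < n.+1)%N -> R i (f i)]].
    move=> k; apply: contrapT => nR; apply: nk; exists k => e ed ek R RN gR.
    apply: nR; exists R; split => //.
      by move=> i ilt; rewrite -ed //; exact/RN/leqW.
    by rewrite -ek; exact: RN.
  have [|Q cQ Qcov] := @N_select (fun k => R k n).
    by move=> k; have [] := RP k.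
  apply: (bd (fun i => \bigcap_(k in Q) R k i)).
    by move=> i ilt; apply: N_bigcap => // k _; have [+ _ _] := RP k; exact.
  have /choice[Z ZP] : forall k, exists Z : set X_omega, [/\ Z `<=` P, countable Z &
      [set f | forall i, (i < n.+1)%N -> R k i (f i)] `&` P `<=` \bigcup_(q in Z) O q].
    by move=> k; have [_ _] := RP k.
  exists (\bigcup_(k in Q) Z k); split.
  - by move=> f [k _]; have [+ _ _] := ZP k; exact.
  - by apply: bigcup_countable => // k _; have [] := ZP k.
  - move=> f [Rf Pf]; have [k Qk Rkf] := Qcov _ (Pf n).
    have [_ _ Zcov] := ZP k; have [|q Zq Oq] := Zcov f.
      split => // i; rewrite ltnS leq_eqVlt => /orP[/eqP -> //|ilt].
      exact: Rf.
    by exists q => //; exists k.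
have [k0 _] : exists k : K, True.
  apply: contrapT => nK; apply: nP; exists set0; split => //.
  have [k|Q cQ Qcov] := @N_select (fun=> set0); first by case: nK; exists k.
  by move=> f Pf; have [k] := Qcov _ (Pf 0%N); case: nK; exists k.
have /choice[nxt nxtP] : forall nd : nat * (nat -> K), exists k, bad nd.1 nd.2 ->
    forall e, (forall i, (i < nd.1)%N -> e i = nd.2 i) -> e nd.1 = k -> bad nd.1.+1 e.
  move=> [n d]; have [bd|nbd] := pselect (bad n d); last by exists k0 => /nbd.
  by have [k kP] := step n d bd; exists k.
pose fix_ n d : nat -> K := fun i => if i == n then nxt (n, d) else d i.
pose D := fix D n := if n is m.+1 then fix_ m (D m) else (fun=> k0).
have badD n : bad n (D n).
  elim: n => [|n IH].
    move=> R _ [Q [QP cQ Qcov]]; apply: nP; exists Q; split => //.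
    by move=> f Pf; apply: Qcov; split.
  apply: (nxtP (n, D n) IH) => [i ilt /=|/=]; rewrite /fix_ ?eqxx //.
  by rewrite ifN // neq_ltn ilt.
pose d i := D i.+1 i.
have Dd n i : (i < n)%N -> D n i = d i.
  elim: n => // n IH; rewrite ltnS leq_eqVlt => /orP[/eqP -> //|ilt].
  by rewrite /= /fix_ ifN ?IH // neq_ltn ilt.
have {}badD n R : (forall i, (i < n)%N -> N (d i) (R i)) ->
    ~ good [set f | forall i, (i < n)%N -> R i (f i)].
  by move=> RN; apply: (badD n) => i ilt; rewrite Dd //; exact: RN.
have C0 i : C (d i) !=set0.
  apply/set0P/eqP => Ci0; apply: (badD i.+1 (fun l => if l == i then set0 else setT)).
    move=> l _; have [->|_] := eqVneq l i.
      by apply: N_open; [exact: open0|rewrite Ci0].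
    by apply: N_open; [exact: openT|].
  exists set0; split => //.
  by move=> f [/(_ i (ltnSn i))]; rewrite eqxx.
have cC : compact [set f : X_omega | forall i, C (d i) (f i)].
  exact: (@tychonoff nat (fun=> X) (fun i => C (d i)) (fun i => @C_compact (d i))).
have /choice[FU FUP] : forall f : X_omega, exists FU : nat * (nat -> set X), P f ->
    (forall i, open_nbhs (f i) (FU.2 i)) /\
    [set g | forall i, (i < FU.1)%N -> FU.2 i (g i)] `<=` O f.
  move=> f; have [Pf|nPf] := pselect (P f); last by exists (0%N, fun=> set0) => /nPf.
  have [F [U [oU UO]]] := nbhs_box (nO f Pf).
  exists ((\max_(i <- F) i.+1)%N, U) => _; split => //= g gU; apply: UO => i iF.
  by apply: gU; exact: (@leq_bigmax_seq _ _ _ (fun i => i.+1) i).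
have CP f : (forall i, C (d i) (f i)) -> P f by move=> Cf i; exact: CY (Cf i).
have [f Cf|E [EC Ecov]] := compact_finite_subcover (O := fun f : X_omega =>
    [set g : X_omega | forall i, (i < (FU f).1)%N -> (FU f).2 i (g i)]) cC.
  have [oU _] := FUP f (CP f Cf).
  have : nbhs f (box (iota 0 (FU f).1) (FU f).2).
    by apply: box_nbhs => i _; exact: open_nbhs_nbhs.
  by apply: filterS => g gU i ilt; apply: gU; rewrite mem_iota.
pose n := (\max_(f <- E) (FU f).1)%N.
(* a point of R i lies in every i-th factor that contains a suitable x of C (d i), so
   a point of the product of the R i follows a point of the product of the C (d i)
   into its box *)
pose R i := [set z | exists2 x, C (d i) x & forall f, f \in E ->
  (i < (FU f).1)%N -> (FU f).2 i x -> (FU f).2 i z].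
apply: (badD n R).
  move=> i _; apply: N_open; last by move=> x Cx; exists x.
  rewrite openE => z [x Cx xz].
  have : nbhs z [set z | forall f, f \in E ->
      (i < (FU f).1)%N -> (FU f).2 i x -> (FU f).2 i z].
    elim: E EC xz {Ecov n R} => [|f E IH] EC xz; first by apply: filterS filterT.
    have nE := IH (fun g gE => EC g (mem_behead (s := f :: E) gE))
      (fun g gE => xz g (mem_behead (s := f :: E) gE)).
    have [oU _] := FUP f (CP f (EC f (mem_head _ _))).
    have nf : nbhs z [set z | (i < (FU f).1)%N -> (FU f).2 i x -> (FU f).2 i z].
      have [[ilt Ux]|n] := pselect ((i < (FU f).1)%N /\ (FU f).2 i x); last first.
        by apply: filterS filterT => w _ ilt Ux; case: n.
      have : nbhs z ((FU f).2 i).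
        apply: open_nbhs_nbhs; split; first by have [] := oU i.
        by apply: xz => //; exact: mem_head.
      by apply: filterS => w Uw _ _.
    apply: filterS (filterI nf nE) => w [wf wE] g.
    by rewrite in_cons => /orP[/eqP ->|/wE].
  by apply: filterS => w wP; exists x.
exists [set` E]; split.
- by move=> f /EC/CP.
- exact/finite_set_countable/finite_seq.
- move=> f [Rf _].
  have /choice[x xP] : forall i, exists x, C (d i) x /\ ((i < n)%N -> forall g, g \in E ->
      (i < (FU g).1)%N -> (FU g).2 i x -> (FU g).2 i (f i)).
    move=> i; have [ilt|ige] := ltnP i n; last first.
      by have [x Cx] := C0 i; exists x.
    by have [x Cx xf] := Rf i ilt; exists x.
  have [|g gE gx] := Ecov x; first by move=> i; have [] := xP i.
  exists g => //; have [_] := FUP g (CP g (EC g gE)); apply => i ilt.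
  have [_ xf] := xP i; apply: xf => //; last exact: gx.
  by apply: leq_trans ilt _; exact: (@leq_bigmax_seq _ _ _ (fun g => (FU g).1) g).
Qed.

End CountablePower.

(** * A coarse topology on the closure of a small set *)

Lemma countable_range (A : Type) (S : set A) : countable S -> S !=set0 ->
  exists v : nat -> A, range v = S.
Proof.
move=> /countable_injP[g injg] [s0 Ss0].
have /choice[v vP] : forall n, exists s, S s /\ forall t, S t -> g t = n -> s = t.
  move=> n; have [[s [Ss gs]]|ns] := pselect (exists s, S s /\ g s = n).
    by exists s; split => // t St gt; apply: injg; rewrite ?inE //; congruence.
  by exists s0; split => // t St gt; case: ns; exists t.
exists v; rewrite eqEsubset; split=> [_ [n _ <-]|s Ss]; first by have [] := vP n.
by exists (g s) => //; have [_ +] := vP (g s); exact.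
Qed.

Section LindelofRegular.
Variable X : topologicalType.
Hypothesis regX : regular_space X.

Lemma lindelof_in_open_seq (S : set X) (P : set (set X)) :
  lindelof_in S -> P set0 ->
  (forall x, S x -> exists U, open_nbhs x U /\ P U) ->
  exists U : nat -> set X,
    (forall n, open (U n) /\ P (U n)) /\ S `<=` \bigcup_n U n.
Proof.
move=> lS P0 SP.
have /choice[O OP] : forall x, exists U, S x -> open_nbhs x U /\ P U.
  move=> x; have [Sx|nSx] := pselect (S x); last by exists set0 => /nSx.
  by have [U UP] := SP x Sx; exists U.
have [x Sx|Q [QS cQ Qcov]] := lS O.
  by have [oU _] := OP x Sx; exact: open_nbhs_nbhs.
have [Q0|/set0P Q0] := eqVneq Q set0.
  exists (fun=> set0); split; first by split => //; exact: open0.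
  by move=> x /Qcov[q]; rewrite Q0.
have [v vQ] := countable_range cQ Q0.
exists (O \o v); split=> [n|x /Qcov[q Qq Oq]].
  have Qv : Q (v n) by rewrite -vQ; exists n.
  by have [[oO _] PO] := OP _ (QS _ Qv).
by move: Qq Oq; rewrite -vQ => -[n _ <-]; exists n.
Qed.

Lemma open_forall_le (A : nat -> set X) n : (forall k, open (A k)) ->
  open [set x | forall k, (k <= n)%N -> A k x].
Proof.
move=> oA; elim: n => [|n IH].
  suff -> : [set x | forall k, (k <= 0)%N -> A k x] = A 0%N by [].
  rewrite eqEsubset; split=> x; first exact.
  by move=> Ax k; rewrite leqn0 => /eqP ->.
suff -> : [set x | forall k, (k <= n.+1)%N -> A k x] =
    [set x | forall k, (k <= n)%N -> A k x] `&` A n.+1 by exact: openI.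
rewrite eqEsubset; split=> x.
  by move=> Ax; split=> [k kn|]; apply: Ax => //; exact: leqW.
move=> [Ax An] k; rewrite leq_eqVlt => /orP[/eqP -> //|]; rewrite ltnS; exact: Ax.
Qed.

(** The usual proof that regular Lindelof spaces are normal: from each member of a
    countable cover of one set, remove the closures of the members of the other
    cover that come no later. *)
Lemma lindelof_separation (A B : set X) : lindelof_in A -> lindelof_in B ->
  closed A -> closed B -> A `&` B = set0 ->
  exists W, [/\ open W, A `<=` W & closure W `&` B = set0].
Proof.
move=> lA lB clA clB AB.
have away (S : set X) x : closed S -> ~ S x ->
    exists U, open_nbhs x U /\ closure U `&` S = set0.
  move=> clS nSx; have [|V nV clV] := @regX x (~` S).
    by apply: open_nbhs_nbhs; split => //; exact: closed_openC.
  exists V°; split; first by split; [exact: open_interior|].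
  rewrite -subset0 => y [/(closureS (@interior_subset _ V))/clV]; exact.
have [||U [UP AU]] := @lindelof_in_open_seq A [set U | closure U `&` B = set0] lA.
- by rewrite /= closure0 set0I.
- by move=> x Ax; apply: away => // Bx; have : (A `&` B) x by []; rewrite AB.
have [||V [VP BV]] := @lindelof_in_open_seq B [set U | closure U `&` A = set0] lB.
- by rewrite /= closure0 set0I.
- by move=> x Bx; apply: away => // Ax; have : (A `&` B) x by []; rewrite AB.
pose UV n := U n `&` [set x | forall k, (k <= n)%N -> (~` closure (V k)) x].
pose VU n := V n `&` [set x | forall k, (k <= n)%N -> (~` closure (U k)) x].
exists (\bigcup_n UV n); split.
- apply: bigcup_open => n _; apply: openI; first by have [] := UP n.
  by apply: open_forall_le => k; exact/closed_openC/closed_closure.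
- move=> x Ax; have [n _ Ux] := AU x Ax; exists n => //; split => // k _ Vx.
  have [_ VA] := VP k; have : (closure (V k) `&` A) x by [].
  by rewrite VA.
- rewrite -subset0 => x [clx Bx]; have [n _ Vx] := BV x Bx.
  have nVU : nbhs x (VU n).
    apply: open_nbhs_nbhs; split.
      apply: openI; first by have [] := VP n.
      by apply: open_forall_le => k; exact/closed_openC/closed_closure.
    split => // k _ Ux; have [_ UB] := UP k; have : (closure (U k) `&` B) x by [].
    by rewrite UB.
  have [y [[m _ [Uy nVy]] [Vy nUy]]] := clx _ nVU.
  have [mn|nm] := leqP m n; first by apply: (nUy m mn); exact: subset_closure.
  by apply: (nVy n (ltnW nm)); exact: subset_closure.
Qed.

End LindelofRegular.

Lemma tightness_sequence (X : topologicalType) (A : set X) (x : X) :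
  countable_tightness X -> closure A x ->
  exists v : nat -> X, range v `<=` A /\ closure (range v) x.
Proof.
move=> tX clA; have [B [BA cB clB]] := tX A x clA.
have [|v vB] := countable_range cB; last by exists v; rewrite vB.
by have [y []] := clB _ (@filterT _ (nbhs x) _); exists y.
Qed.

Lemma closure_common_sequence (X : topologicalType) (S : Type) (h : S -> X)
    (s0 : S) (y : nat -> X) :
  countable_tightness X -> (forall n, closure (range h) (y n)) ->
  exists u : nat -> S, forall n, closure (range (h \o u)) (y n).
Proof.
move=> tX Yy.
have /choice[w wP] : forall n, exists w : nat -> S, closure (range (h \o w)) (y n).
  move=> n; have [v [vh clv]] := tightness_sequence tX (Yy n).
  have /choice[w wP] : forall k, exists s, h s = v k.
    by move=> k; have [|s _ hs] := vh (v k); [exists k|exists s].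
  by exists w; rewrite (_ : h \o w = v) //; apply: funext => k /=.
exists (fun m => if unpickle m is Some (n, k) then w n k else s0) => n.
apply: closureS (wP n) => _ [k _ <-].
by exists (pickle (n, k)) => //=; rewrite pickleK.
Qed.

Section CoarseSpace.
Variables (X : topologicalType) (S : choiceType) (h : S -> X) (s0 : S).
Hypothesis lX : lindelof X.
Hypothesis tX : countable_tightness X.

Let regX : regular_space X. Proof. by case: lX. Qed.

Let lclosed (A : set X) : closed A -> lindelof_in A.
Proof.
move=> clA; rewrite -(setTI A); apply: lindelof_in_closed => //.
exact: lindelof_lindelof_in.
Qed.

Let Y : set X := closure (range h).

Let clY : closed Y. Proof. exact: closed_closure. Qed.

(** An index is a sequence [u] together with two parts [N] and [N'] of it. Where
    their closures are disjoint, the coordinate of this index will separate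
    them. *)
Definition index : Type := ((nat -> S) * set nat * set nat)%type.
HB.instance Definition _ := Choice.on index.

Definition part (u : nat -> S) (N : set nat) : set X := (h \o u) @` N.

Let separator (i : index) : exists W : set X, open W /\
  (closure (part i.1.1 i.1.2) `&` closure (part i.1.1 i.2) = set0 ->
   closure (part i.1.1 i.1.2) `<=` W /\
   closure W `&` closure (part i.1.1 i.2) = set0).
Proof.
case: i => [[u N] N'] /=.
have [disj|ndisj] := pselect (closure (part u N) `&` closure (part u N') = set0);
  last by exists set0; split; [exact: open0|move=> /ndisj].
have cl A := @closed_closure X A.
have [W [oW NW WN']] :=
  lindelof_separation regX (lclosed (cl _)) (lclosed (cl _)) (cl _) (cl _) disj.
by exists W.
Qed.

Let W (i : index) : set X := sval (cid (separator i)).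

Let W_open i : open (W i).
Proof. by have [] := svalP (cid (separator i)). Qed.

Let W_sep u N N' : closure (part u N) `&` closure (part u N') = set0 ->
  closure (part u N) `<=` W (u, N, N') /\
  closure (W (u, N, N')) `&` closure (part u N') = set0.
Proof. by have [_] := svalP (cid (separator (u, N, N'))). Qed.

(* A coordinate true at a says that x lies in the closure of W i, and a coordinate
   false at a says that x lies outside W i. Both may be consistent with the same x;
   this keeps the relation closed. *)
Let compat (x : X) (a : cube index) :=
  forall i, if a i then closure (W i) x else ~ W i x.

Let T : set (cube index) := [set a | exists2 x, Y x & compat x a].

Let compat_exists x : exists a, compat x a.
Proof.
exists (fun i => `[< closure (W i) x >]) => i.
by case: asboolP => // ncl Wx; apply: ncl; exact: subset_closure.
Qed.

Let compat_open x a : ~ compat x a -> exists i V,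
  nbhs x V /\ forall y b, V y -> b i = a i -> ~ compat y b.
Proof.
move=> /existsNP[i]; case ai : (a i) => nc.
  exists i, (~` closure (W i)); split.
    by apply: open_nbhs_nbhs; split => //; exact/closed_openC/closed_closure.
  by move=> y b nWy bi /(_ i); rewrite bi ai.
exists i, (W i); split.
  by apply: open_nbhs_nbhs; split => //; exact: contrapT.
by move=> y b Wy bi /(_ i); rewrite bi ai.
Qed.

(** [T] is the projection of a closed subset of [X * cube index], so the product
    of [T] with [B] is handled by the product of [X] with [cube index * B]. *)
Let T_productively_lindelof :
  productively_lindelof X -> productively_lindelof_in T.
Proof.
move=> prodX B lB.
have aB : accessible_space B by case: lB.
have rB : regular_space B by case: lB.
have lKB : lindelof (cube index * B)%type.
  apply: lindelof_in_lindelof.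
  - apply: accessible_prod => //; apply: accessible_prod_topology => _.
    exact/hausdorff_accessible/discrete_hausdorff.
  - apply: regular_prod => //; apply: regular_prod_topology => _.
    exact: uniform_regular.
  - apply: lindelof_in_compact_prod; first exact: compact_cube.
    exact: lindelof_lindelof_in.
pose C : set (X * (cube index * B)) := [set p | Y p.1 /\ compat p.1 p.2.1].
have clC : closed C.
  move=> [x [a b]] clx; split => /=.
    apply: clY => V nV; have [|[y [c d]] [[/= Yy _] [/= Vy _]]] := clx (V `*` setT).
      by exists (V, setT) => //; split => //; exact: filterT.
    by exists y.
  apply: contrapT => /compat_open[i [V [nV Vn]]].
  have [|[y [c d]] [[/= _ yc] [/= Vy [/= ci _]]]] :=
      clx (V `*` ([set c | c i = a i] `*` setT)).
    exists (V, [set c | c i = a i] `*` setT) => //; split => //=.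
    exists ([set c | c i = a i], setT) => //; split => //=; last exact: filterT.
    exact: nbhs_coordinate.
  exact: Vn yc.
have -> : T `*` [set: B] = snd @` ([set: X * (cube index * B)] `&` C).
  rewrite eqEsubset; split=> [[a b] [/= [x Yx xa] _]|_ [[x [a b]] [_ [/= Yx xa]] <-]].
    by exists (x, (a, b)).
  by split => //; exists x.
apply: lindelof_in_image; first by move=> p; exact: cvg_snd.
apply: lindelof_in_closed => //; apply: lindelof_lindelof_in.
exact: prodX.
Qed.

(** On the closure of the sequence [u] the sets [W (u, N, N')] recover the topology
    of [X]. The two parts of [u] are its terms in a small neighbourhood of [x] and
    its terms outside a larger one. *)
Let separates (u : nat -> S) x U : closure (range (h \o u)) x -> nbhs x U ->
  exists i, W i x /\
    forall y, closure (range (h \o u)) y -> closure (W i) y -> U y.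
Proof.
move=> clx nU; have [V2 nV2 clV2] := regX nU.
have [V nV clV] := regX (nbhs_interior nV2).
pose N : set nat := [set n | V (h (u n))].
pose N' : set nat := [set n | ~ V2 (h (u n))].
have disj : closure (part u N) `&` closure (part u N') = set0.
  rewrite -subset0 => y [yN yN'].
  have Vy : V2° y by apply: clV; apply: closureS yN => _ [n Vn <-].
  by have [_ [[n nVn <-] V2n]] := yN' _ Vy.
have [NW WN'] := W_sep disj; exists (u, N, N'); split.
  apply: NW => B nB; have [_ [[n _ <-] [Vn Bn]]] := clx _ (filterI nV nB).
  by exists (h (u n)); split => //; exists n.
move=> y cly Wy; apply: clV2 => B nB; apply: contrapT => nV2B.
have : (closure (W (u, N, N')) `&` closure (part u N')) y; last by rewrite WN'.
split => // B' nB'; have [_ [[n _ <-] [Bn B'n]]] := cly _ (filterI nB nB').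
exists (h (u n)); split => //; exists n => //= V2n.
by apply: nV2B; exists (h (u n)).
Qed.

(** By tightness [x] is in the closure of a sequence [w]; even positions of the
    index list the terms of [w], odd positions those of [u]. *)
Let separates_closure (u : nat -> S) x : Y x -> ~ closure (range (h \o u)) x ->
  exists i, W i x /\
    forall y, closure (range (h \o u)) y -> ~ closure (W i) y.
Proof.
move=> Yx nclx; have [v [vh clv]] := tightness_sequence tX Yx.
have /choice[w wP] : forall n, exists s, h s = v n.
  by move=> n; have [|s _ hs] := vh (v n); [exists n|exists s].
have [V nV clV] : exists2 V, nbhs x V & closure V `<=` ~` closure (range (h \o u)).
  have [|V nV clV] := @regX x (~` closure (range (h \o u))); last by exists V.
  by apply: open_nbhs_nbhs; split => //; exact/closed_openC/closed_closure.
pose t n := if odd n then u n./2 else w n./2.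
pose N : set nat := [set n | ~~ odd n /\ V (h (t n))].
pose N' : set nat := [set n | odd n].
have tu : part t N' = range (h \o u).
  rewrite eqEsubset; split=> _ [n on <-].
    by exists n./2 => //=; rewrite /t ifT.
  exists n.*2.+1; first by rewrite /N' /= odd_double.
  by rewrite /= /t /= odd_double uphalf_double.
have disj : closure (part t N) `&` closure (part t N') = set0.
  rewrite tu -subset0 => y [yN]; apply: clV; apply: closureS yN => _ [n [_ Vn] <-] //.
have [NW] := W_sep disj; rewrite tu => WN'; exists (t, N, N'); split.
  apply: NW => B nB; have [_ [[n _ <-] [Vn Bn]]] := clv _ (filterI nV nB).
  exists (v n); split => //; exists n.*2; rewrite /N /= /t odd_double doubleK wP //.
by move=> y cly Wy; have : (set0 : set X) y by rewrite -WN'.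
Qed.

Let fiber (D : set (cube index)) : set X :=
  [set x | Y x /\ exists2 a, D a & compat x a].

(** The tube lemma for the closed relation [compat]. *)
Let incompatible_nbhs D x : closed D -> (forall a, D a -> ~ compat x a) ->
  exists (F : seq index) V, nbhs x V /\
    forall y a, V y -> sat [set` F] D a -> ~ compat y a.
Proof.
move=> clD Dx.
have /choice[k kP] : forall a, exists iV : option index * set X, D a ->
    exists i, [/\ iV.1 = Some i, nbhs x iV.2 &
      forall y b, iV.2 y -> b i = a i -> ~ compat y b].
  move=> a; have [Da|nDa] := pselect (D a); last by exists (None, set0) => /nDa.
  have [i [V [nV VP]]] := compat_open (Dx a Da).
  by exists (Some i, V) => _; exists i.
have [a Da|E [ED Ecov]] := compact_finite_subcover
    (O := fun a => [set b | forall i, (k a).1 = Some i -> b i = a i])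
    (closed_compact_cube clD).
  have [i [-> _ _]] := kP a Da.
  by apply: filterS (nbhs_coordinate i a) => b bi _ [<-].
exists (pmap (fun a => (k a).1) E), [set y | forall a, a \in E -> (k a).2 y]; split.
  elim: E ED {Ecov} => [|a E IH] ED; first by apply: filterS filterT.
  have nE : nbhs x [set y | forall a, a \in E -> (k a).2 y].
    by apply: IH => b bE; apply: ED; rewrite in_cons bE orbT.
  have [i [_ na _]] := kP a (ED a (mem_head _ _)).
  apply: filterS (filterI na nE) => y [ay Ey] b.
  by rewrite in_cons => /orP[/eqP ->|/Ey].
move=> y b Vy [c Dc bc]; have [a aE ac] := Ecov c Dc.
have [i [ki _ nc]] := kP a (ED a aE); apply: nc; first exact: Vy.
rewrite -(ac i ki); apply: bc; rewrite /= mem_pmap -ki.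
exact: (map_f (fun a => (k a).1)).
Qed.

Let fiber_closed D : closed D -> closed (fiber D).
Proof.
move=> clD x clx.
have Yx : Y x by apply: clY; apply: closureS clx => y [].
split => //; apply: contrapT => nD.
have [|F [V [nV VP]]] := @incompatible_nbhs D x clD.
  by move=> a Da xa; apply: nD; exists a.
have [y [[_ [a Da ya]] Vy]] := clx V nV.
by apply: (VP y a Vy _ ya); exact: sub_sat.
Qed.

(** The part of the closure of the range of [h] outside [U] is Lindelof, so it is
    covered by countably many neighbourhoods as in [incompatible_nbhs], and each of
    these comes with finitely many coordinates. *)
Let fiber_nbhs D U : closed D -> open U -> fiber D `<=` U ->
  exists2 J : set index, countable J & fiber (sat J D) `<=` U.
Proof.
move=> clD oU DU.
have /choice[FV FVP] : forall x, exists FV : seq index * set X, (Y `&` ~` U) x ->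
    nbhs x FV.2 /\ forall y a, FV.2 y -> sat [set` FV.1] D a -> ~ compat y a.
  move=> x; have [[Yx nUx]|n] := pselect ((Y `&` ~` U) x);
    last by exists ([::], set0) => /n.
  have [|F [V VP]] := @incompatible_nbhs D x clD; last by exists (F, V).
  by move=> a Da xa; apply: nUx; apply: DU; split => //; exists a.
have [|x Yx|Q [QY cQ Qcov]] := @lclosed (Y `&` ~` U) _ (fun x => (FV x).2).
- by apply: closedI => //; exact: open_closedC.
- by have [] := FVP x Yx.
exists (\bigcup_(q in Q) [set` (FV q).1]).
  by apply: bigcup_countable => // q _; exact/finite_set_countable/finite_seq.
move=> y [Yy [a Da ya]]; apply: contrapT => nUy.
have [q Qq Vy] := Qcov y (conj Yy nUy); have [_ VP] := FVP q (QY q Qq).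
by apply: (VP y a Vy _ ya); apply: sat_anti Da => i iF; exists q.
Qed.

(** A sequence in the fiber of [D] lies in the closure of one sequence of the
    range of [h], and there the coordinates of a cluster point of compatible
    points of [D] converge to those of a point of the fiber. *)
Let fiber_countably_compact D (O : nat -> set X) : closed D -> D `<=` T ->
  (forall n, open (O n)) -> (forall m n, (m <= n)%N -> O m `<=` O n) ->
  fiber D `<=` \bigcup_n O n -> exists n, fiber D `<=` O n.
Proof.
move=> clD DT oO mO Dcov; apply: contrapT => nex.
have /choice[ya yaP] : forall n, exists ya : X * cube index,
    [/\ Y ya.1, D ya.2, compat ya.1 ya.2 & ~ O n ya.1].
  move=> n; have /existsNP[y /not_implyP[[Yy [a Da aya]] nOy]] : ~ (fiber D `<=` O n).
    by move=> sub; apply: nex; exists n.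
  by exists (y, a).
have [u uP] : exists u : nat -> S, forall n, closure (range (h \o u)) (ya n).1.
  by apply: closure_common_sequence => // n; have [] := yaP n.
have [a Da aP] : exists2 a, D a & forall F n, exists2 m, (n <= m)%N & cyl F a (ya m).2.
  apply: contrapT => na.
  have /choice[Fn FnP] : forall a, exists Fn : seq index * nat, D a ->
      forall m, (Fn.2 <= m)%N -> ~ cyl Fn.1 a (ya m).2.
    move=> a; have [Da|nDa] := pselect (D a); last by exists ([::], 0%N) => /nDa.
    apply: contrapT => nFn; apply: na; exists a => // F n.
    apply: contrapT => nm; apply: nFn; exists (F, n) => _ m nm' am.
    by apply: nm; exists m.
  have [a Da|E [ED Ecov]] := compact_finite_subcover
      (O := fun a => cyl (Fn a).1 a) (closed_compact_cube clD); first exact: cyl_nbhs.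
  pose m := (\max_(a <- E) (Fn a).2)%N.
  have [_ Dm _ _] := yaP m; have [a aE am] := Ecov _ Dm.
  apply: (FnP a (ED a aE) m) => //.
  exact: (@leq_bigmax_seq _ _ _ (fun a => (Fn a).2) a).
have [x Yx xa] := DT a Da.
have ai i : W i x -> a i by move=> Wx; have := xa i; case: (a i).
have later i n : a i -> exists2 m, (n <= m)%N & closure (W i) (ya m).1.
  move=> ati; have [m nm am] := aP [:: i] n; exists m => //.
  have [_ _ /(_ i) + _] := yaP m; rewrite -(am i) ?ati //=.
  exact: mem_head.
have [clx|nclx] := pselect (closure (range (h \o u)) x); last first.
  have [i [Wx nW]] := separates_closure Yx nclx.
  by have [m _ Wm] := later i 0%N (ai i Wx); apply: (nW _ (uP m)).
have [|n _ Onx] := Dcov x; first by split => //; exists a.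
have [i [Wx WO]] := separates clx (open_nbhs_nbhs (conj (oO n) Onx)).
have [m nm Wm] := later i n (ai i Wx).
have [_ _ _] := yaP m; apply; apply: (mO n m nm); exact: WO.
Qed.

(** The fiber is Lindelof, being closed, so countable compactness suffices. *)
Let fiber_compact D : closed D -> D `<=` T -> compact (fiber D).
Proof.
move=> clD DT B PB BD; apply: contrapT => ncl.
have /choice[NA NAP] : forall x, exists NA : set X * set X, fiber D x ->
    [/\ nbhs x NA.1, B NA.2 & NA.1 `&` NA.2 = set0].
  move=> x; have [Dx|nDx] := pselect (fiber D x); last by exists (set0, set0) => /nDx.
  apply: contrapT => nNA; apply: ncl; exists x; split => // A N BA nN.
  apply/set0P/eqP => AN; apply: nNA; exists (N, A) => _; split => //.
  by rewrite setIC.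
have [x Dx|Q [QD cQ Qcov]] := lclosed (fiber_closed clD) (O := fun x => (NA x).1°).
  by apply: nbhs_interior; have [] := NAP x Dx.
have [Q0|/set0P Q0] := eqVneq Q set0.
  by have [x /Qcov[q]] := filter_ex BD; rewrite Q0.
have [v vQ] := countable_range cQ Q0.
have Qv n : Q (v n) by rewrite -vQ; exists n.
pose O n := \bigcup_(k in [set k | (k <= n)%N]) (NA (v k)).1°.
have [|||n Dn] := @fiber_countably_compact D O clD DT.
- by move=> n; apply: bigcup_open => k _; exact: open_interior.
- by move=> m n mn x [k km Nx]; exists k => //; exact: leq_trans mn.
- move=> x /Qcov[q]; rewrite -vQ => -[n _ <-] Nx; exists n => //.
  by exists n => /=.
have BO : B (\bigcap_(k in [set k | (k <= n)%N]) (NA (v k)).2).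
  elim: n {Dn} => [|n IH].
    have [_ B0 _] := NAP (v 0%N) (QD _ (Qv 0%N)).
    by apply: filterS B0 => x Ax k; rewrite /= leqn0 => /eqP ->.
  have [_ Bn _] := NAP (v n.+1) (QD _ (Qv n.+1)).
  apply: filterS (filterI IH Bn) => x [Ax An] k /=.
  by rewrite leq_eqVlt => /orP[/eqP -> //|]; rewrite ltnS; exact: Ax.
have [x [Dx Ax]] := filter_ex (filterI BD BO).
have [k kn /interior_subset Nx] := Dn x Dx.
have [_ _ N0] := NAP (v k) (QD _ (Qv k)).
have : ((NA (v k)).1 `&` (NA (v k)).2) x by split => //; exact: Ax.
by rewrite N0.
Qed.

(** The members of the filter attached to a compact [D] contain the fiber of a
    saturation of [D] for countably many coordinates; Alster's theorem is the
    selection principle for these filters. *)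
Lemma lindelof_in_power_closure (lt : set nat -> set nat -> Prop) :
  omega1_order lt -> continuum_sized S -> productively_lindelof X ->
  lindelof_in [set f : prod_topology (fun _ : nat => X) |
    forall n, closure (range h) (f n)].
Proof.
move=> omega1M sizeS prodX.
have sizeI : continuum_sized index.
  have sizeN := continuum_sized_set nat.
  have sizeSN := continuum_sized_seq sizeS.
  exact: continuum_sized_prod (continuum_sized_prod sizeSN sizeN) sizeN.
have i0 : index by exact: (fun=> s0, set0, set0).
pose K := {D : set (cube index) | closed D /\ D `<=` T}.
apply: (@lindelof_in_countable_power X Y K (fun k => fiber (sval k))
  (fun k R => exists2 J, countable J & fiber (sat J (sval k)) `<=` R)).
- by move=> k x [].
- by move=> [D [clD DT]]; exact: fiber_compact.
- by move=> [D [clD DT]] U oU DU; exact: fiber_nbhs.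
- move=> k Q R cQ QR.
  have /choice[J JP] : forall l, exists J : set index, Q l ->
      countable J /\ fiber (sat J (sval k)) `<=` R l.
    move=> l; have [Ql|nQl] := pselect (Q l); last by exists set0 => /nQl.
    by have [J cJ JR] := QR l Ql; exists J.
  exists (\bigcup_(l in Q) J l); first by apply: bigcup_countable => // l /JP[].
  move=> x [Yx [a Da xa]] l Ql; have [_] := JP l Ql; apply.
  split => //; exists a => //; apply: sat_anti Da => i Ji; by exists l.
- move=> R NR.
  have /choice[J JP] : forall D, exists J : set index, countable J /\
      forall k : K, sval k = D -> fiber (sat J D) `<=` R k.
    move=> D; have [DP|nD] := pselect (closed D /\ D `<=` T); last first.
      exists set0; split; first exact: countable0.
      by move=> [D' D'P] /= DD'; case: nD; rewrite -DD'.
    have [J cJ JR] := NR (exist _ D DP); exists J; split => // -[D' D'P] /= DD'.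
    by subst D'; rewrite (Prop_irrelevance D'P DP).
  have [|Q [cQ QT Qcov]] :=
    alster (J := J) i0 omega1M sizeI (T_productively_lindelof prodX).
    by move=> D; have [] := JP D.
  exists [set k : K | Q (sval k)].
    apply: (@countable_inj _ _ (@sval _ _)).
      move=> [D DP] [D' D'P] _ _ /= DD'.
      by subst D'; rewrite (Prop_irrelevance D'P DP).
    by apply: sub_countable_set cQ => _ [k Qk <-].
  move=> y Yy; have [a ya] := compat_exists y.
  have [|D QD Da] := Qcov a; first by exists y.
  exists (exist _ D (QT D QD)) => //; have [_] := JP D; apply => //.
  by split => //; exists a.
Qed.

End CoarseSpace.

(** * Closing off *)

(** Terms for the closing-off: [Leaf] names a fixed point. In [Node l u] the trees
    [u] name countably many sequences of points, the values [l k.+1] choose a member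
    of the countable cover belonging to the [k]-th sequence, and [l 0] is a
    coordinate of a point missed by all of these members. *)
Inductive tree := Leaf | Node of (nat -> nat) & (nat -> tree).

(** A well-founded tree is determined by its set of labelled finite branches. *)
Fixpoint branches (t : tree) : set (seq nat * (nat * nat)) :=
  match t with
  | Leaf => set0
  | Node l u => [set p | match p.1 with
      | [::] => exists k, p.2 = (k, l k)
      | k :: s => branches (u k) (s, p.2)
      end]
  end.

Lemma branches_inj : injective branches.
Proof.
elim=> [|l u IH] [|l' u'] //= e.
- have := congr1 (fun A : set (seq nat * (nat * nat)) => A ([::], (0%N, l' 0%N))) e.
  by move=> /= e0; have : False by rewrite [False]e0; exists 0%N.
- have := congr1 (fun A : set (seq nat * (nat * nat)) => A ([::], (0%N, l 0%N))) e.
  by move=> /= e0; have : False by rewrite -[False]e0; exists 0%N.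
- congr Node.
    apply: funext => k.
    have := congr1 (fun A : set (seq nat * (nat * nat)) => A ([::], (k, l k))) e.
    rewrite /= => eq_k.
    have : exists k' : nat, (k, l k) = (k', l' k') by rewrite -eq_k; exists k.
    by move=> [k' [<- ->]].
  apply: funext => k; apply: IH; apply: funext => -[s p].
  exact: (congr1 (fun A : set (seq nat * (nat * nat)) => A (k :: s, p)) e).
Qed.

Lemma continuum_sized_tree : continuum_sized tree.
Proof. exact: continuum_sized_inj branches_inj (continuum_sized_set _). Qed.

Theorem theorem4p3 (CH : continuum_hypothesis) (X : topologicalType)
    (hprod : productively_lindelof X) (htight : countable_tightness X) :
  powerfully_lindelof X.
Proof.
have [lt omega1M] := continuum_omega1_order CH.
have lX := productively_lindelof_lindelof hprod.
have [aX rX _] := lX.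
apply: lindelof_in_lindelof.
- exact: accessible_prod_topology.
- exact: regular_prod_topology.
pose Xo := prod_topology (fun _ : nat => X).
move=> O nO.
have [[x0 _]|nX] := pselect (exists x : X, True); last first.
  by exists set0; split => // f _; case: nX; exists (f 0%N).
(* the members of the open cover *)
pose N (f : Xo) := (O f)°.
have nN f : nbhs f (N f) by apply: nbhs_interior; exact: nO.
(* v u lists a countable subcover for the power of the closure of the sequence u *)
have /choice[v vP] : forall u : nat -> X, exists v : nat -> Xo, forall f : Xo,
    (forall n, closure (range u) (f n)) -> exists k, N (v k) f.
  move=> u.
  have sizen : continuum_sized nat.
    by apply: (@continuum_sized_inj _ _ (fun n : nat => [set n])
        _ (continuum_sized_set nat)) => m n mn; have : [set m] n by rewrite mn.
  have [f _|Q [_ cQ Qcov]] := lindelof_in_power_closure (h := u) 0%N lX htight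
    omega1M sizen hprod (O := N) => //.
  have [|q Qq _] := Qcov (fun=> u 0%N).
    by move=> n; apply: subset_closure; exists 0%N.
  have [|w wQ] := countable_range cQ; first by exists q.
  exists w => f /Qcov[g]; rewrite -wQ => -[k _ <-] Nf.
  by exists k.
(* p w is missed by all the members N (w k), if they do not cover *)
have /choice[p pP] : forall w : nat -> Xo, exists p : Xo,
    (exists f, forall k, ~ N (w k) f) -> forall k, ~ N (w k) p.
  move=> w; have [[f wf]|nf] := pselect (exists f, forall k, ~ N (w k) f).
    by exists f.
  by exists (fun=> x0) => /nf.
pose h := fix h (t : tree) : X := match t with
  | Leaf => x0
  | Node l u => p (fun k => v (fun j => h (u (pickle (k, j)))) (l k.+1)) (l 0%N)
  end.
have lA := lindelof_in_power_closure (S := {classic tree}) (h := h) Leaf lX htight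
  omega1M continuum_sized_tree hprod.
have /choice[uk ukP] : forall f : Xo, exists uk : (nat -> tree) * nat,
    (forall n, closure (range h) (f n)) -> N (v (h \o uk.1) uk.2) f.
  move=> f; have [Af|nAf] := pselect (forall n, closure (range h) (f n)); last first.
    by exists (fun=> Leaf, 0%N) => /nAf.
  have [u uP] := closure_common_sequence Leaf htight Af.
  by have [k Nk] := vP (h \o u) f uP; exists (u, k).
have [f Af|Q [QA cQ Qcov]] := lA (fun f => N (v (h \o (uk f).1) (uk f).2)).
  by apply: open_nbhs_nbhs; split; [exact: open_interior|exact: ukP].
have Leaf_power : forall n : nat, closure (range h) x0.
  by move=> n; apply: subset_closure; exists Leaf.
have [q Qq _] := Qcov (fun=> x0) Leaf_power.
have [|g gQ] := countable_range cQ; first by exists q.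
pose w k := v (h \o (uk (g k)).1) (uk (g k)).2.
have [cov|ncov] := pselect (forall f, exists k, N (w k) f).
  exists (range w); split => //; first exact/countable_image/countableP.
  move=> f _; have [k Nk] := cov f.
  by exists (w k); [exists k|exact: interior_subset].
(* p w has all its coordinates in the range of h, where the N (w k) do cover *)
have pw : forall k, ~ N (w k) (p w).
  apply: pP; move: ncov => /existsNP[f nf]; exists f => k Nk.
  by apply: nf; exists k.
have [|q' ] := Qcov (p w).
  move=> n; apply: subset_closure.
  exists (Node (fun m => if m is k.+1 then (uk (g k)).2 else n)
    (fun m => if unpickle m is Some (k, j) then (uk (g k)).1 j else Leaf)) => //=.
  congr (p _ n); apply: funext => k; congr (v _ _).
  by apply: funext => j; rewrite pickleK.
by rewrite -gQ => -[k _ <-] /pw.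
Qed.
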